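(* Let $(u_0,u_1)$ be smooth radial real-valued functions on $\mathbb{R}^3$ such that for all $r>0$ $$(u_0)_r(r) + |u_1(r)| < \frac 1 r .$$ Then the equation $$u_{tt}-\Delta u=u_t^2-|\nabla u|^2,\quad u(0)=u_0,\quad u_t(0)=u_1$$ admits a global smooth solution $u$ on $\mathbb{R}^{3+1}$ such that for every $(r,t)$ $$u_r(r,t)+|u_t(r,t)|<\frac 1 r .$$ Furthermore, if $u_0\in L^\infty$, then the condition ($r(u_0)_r,\ r u_1\in L^\infty$ and $(u_0)_r+|u_1|\le \frac{1-\epsilon}{r}$ for some $\epsilon>0$) holds if and only if $u\in L^\infty_{t,x}$. In this case, $$\inf u_0-\ln\big(1+\|r(u_0)_r\|_{L^\infty}+\|ru_1\|_{L^\infty}\big)\le u\le \sup u_0+\ln(1/\epsilon).$$ Also (in this case), let $c_0:=e^{\sup u_0-\inf u_0}\,\epsilon^{-1}\big(1+\|r(u_0)_r\|_{L^\infty}+\|ru_1\|_{L^\infty}\big)$. Then $ru_r,\ ru_t\in L^\infty_{t,x}$ and $$u_r(r,t)+|u_t(r,t)|\le \frac 1 r\Big(1-\frac 1{c_0}\Big),\qquad |u_r(r,t)|+|u_t(r,t)|\le\frac{c_0-1}{r}.$$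
   Context: For a radially symmetric function $u$ on $\mathbb{R}^3$ we write $u(r):=u(x)$ for $|x|=r$, and similarly $u(r,t)$ for functions on $\mathbb{R}^{3+1}=\mathbb{R}^3\times\mathbb{R}$; the subscript $r$ denotes the radial derivative. $L^\infty_{t,x}$ means bounded on $\mathbb{R}^{3+1}$. Solutions are classical (the equation holds pointwise). *)

(* Defs.v *)
From Stdlib Require Import Reals.
From Coquelicot Require Import Coquelicot.
Open Scope R_scope.

(** * Smooth functions on normed modules *)

Definition dir_deriv {V : NormedModule R_AbsRing} (v : V) (f : V -> R) (x : V) : R :=
  Derive (fun s : R => f (plus x (scal s v))) 0.

(* On a finite-dimensional [V] this is the usual class C^k: the directions [v]
   include a basis, so all iterated partial derivatives up to order [k] exist
   and are continuous, which in turn controls every direction. *)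
Fixpoint C_k {V : NormedModule R_AbsRing} (k : nat) (f : V -> R) : Prop :=
  (forall x : V, continuous f x) /\
  match k with
  | O => True
  | S k' => forall v : V,
      (forall x : V, ex_derive (fun s : R => f (plus x (scal s v))) 0) /\
      C_k k' (dir_deriv v f)
  end.

Definition smooth {V : NormedModule R_AbsRing} (f : V -> R) : Prop :=
  forall k : nat, C_k k f.

(** * Space and space-time *)

(* Coquelicot's norm on a product is the square root of the sum of the squared
   norms, so [norm] on [space] is the Euclidean norm |x|. *)
Definition space : NormedModule R_AbsRing :=
  prod_NormedModule R_AbsRing
    (prod_NormedModule R_AbsRing R_NormedModule R_NormedModule) R_NormedModule.

Definition spacetime : NormedModule R_AbsRing :=
  prod_NormedModule R_AbsRing space R_NormedModule.

Definition e1 : space := (1, 0, 0).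
Definition e2 : space := (0, 1, 0).
Definition e3 : space := (0, 0, 1).

Definition dx (e : space) (u : spacetime -> R) : spacetime -> R :=
  dir_deriv ((e, 0) : spacetime) u.

Definition dt (u : spacetime -> R) : spacetime -> R :=
  dir_deriv (((0, 0, 0), 1) : spacetime) u.

Definition laplacian (u : spacetime -> R) (p : spacetime) : R :=
  dx e1 (dx e1 u) p + dx e2 (dx e2 u) p + dx e3 (dx e3 u) p.

Definition grad_sq (u : spacetime -> R) (p : spacetime) : R :=
  (dx e1 u p) ^ 2 + (dx e2 u p) ^ 2 + (dx e3 u p) ^ 2.

Definition is_solution (u0 u1 : space -> R) (u : spacetime -> R) : Prop :=
  (forall p : spacetime,
      dt (dt u) p - laplacian u p = (dt u p) ^ 2 - grad_sq u p) /\
  (forall x : space, u (x, 0) = u0 x) /\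
  (forall x : space, dt u (x, 0) = u1 x).

(** * Radial functions *)

Definition radial (f : space -> R) : Prop :=
  forall x y : space, norm x = norm y -> f x = f y.

(* f(r) := f(x) for |x| = r; the representative x = r e1 is immaterial when
   [f] is radial. *)
Definition profile (f : space -> R) (r : R) : R := f (r, 0, 0).

Definition radial_deriv (f : space -> R) (r : R) : R := Derive (profile f) r.

Definition at_time (u : spacetime -> R) (t : R) : space -> R := fun x => u (x, t).

Definition u_r (u : spacetime -> R) (r t : R) : R := radial_deriv (at_time u t) r.

Definition u_t (u : spacetime -> R) (r t : R) : R := profile (at_time (dt u) t) r.

(* The functions r f_r and r f on R^3. *)
Definition r_radial_deriv (f : space -> R) : space -> R :=
  fun x => norm x * radial_deriv f (norm x).

Definition r_times (f : space -> R) : space -> R := fun x => norm x * f x.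

(** * Bounded functions *)

(* All functions below to which these are applied are continuous, so bounds and
   suprema need not be essential. *)
Definition bounded_fun {T : Type} (f : T -> R) : Prop :=
  exists M : R, forall x : T, Rabs (f x) <= M.

(* Meaningful for bounded [f] only: [real] sends infinities to 0. *)
Definition sup_fun {T : Type} (f : T -> R) : R :=
  real (Lub_Rbar (fun y : R => exists x : T, y = f x)).

Definition inf_fun {T : Type} (f : T -> R) : R :=
  real (Glb_Rbar (fun y : R => exists x : T, y = f x)).

Definition norm_inf {T : Type} (f : T -> R) : R := sup_fun (fun x => Rabs (f x)).

(** * The condition on the initial data *)

Definition data_condition (u0 u1 : space -> R) (eps : R) : Prop :=
  0 < eps /\
  bounded_fun (r_radial_deriv u0) /\ bounded_fun (r_times u1) /\
  forall r : R, 0 < r ->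
    radial_deriv u0 r + Rabs (profile u1 r) <= (1 - eps) / r.

Definition data_size (u0 u1 : space -> R) : R :=
  1 + norm_inf (r_radial_deriv u0) + norm_inf (r_times u1).

Definition c_0 (u0 u1 : space -> R) (eps : R) : R :=
  exp (sup_fun u0 - inf_fun u0) * / eps * data_size u0 u1.

(* Main.v *)
Require Import Defs.
From Stdlib Require Import Reals Lra FunctionalExtensionality.
From Coquelicot Require Import Coquelicot.
Open Scope R_scope.

(** The substitution [v = exp (- u)] turns the equation into the linear wave
    equation [v_tt = Delta v], because
    [v_tt - Delta v = - v (u_tt - Delta u - u_t^2 + |grad u|^2)].  For radial data
    [r v] solves the wave equation on the line, so that
    [v(r,t)] is the integral of [g (t + r s)] over [-1 <= s <= 1], where
    [2 g(s) = exp (- u0(s)) (1 - s u0'(s) - s u1(s))] and the profiles [u0], [u1] are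
    extended to negative [s] as even functions.  The hypothesis on the data says
    exactly that [g] is positive away from the origin, where positivity is clear.
    Hence [v > 0] everywhere and [u = - ln v] is globally defined.

    Smoothness of [v] at the spatial origin, where [|x|] is singular, comes from
    the family [wave j g], the integrals of [g (t + |x| s) (1 - s^2)^j].
    Integrating by parts, the derivative of [wave j g] in the direction [(y, tau)] is
    [(x.y) / (2 (j + 1)) * wave (j + 1) g'' + tau * wave j g'] ([wave_is_dir]), at
    [x = 0] too since the integral is even in [r].  The family multiplied by
    polynomials is thus stable under differentiation, which gives all derivatives
    ([wave_C_k]) and, after two more integrations by parts, the wave equation
    ([cone_int_wave_identity]).

    All estimates follow from two identities on the light cone,
    [v + r v_r = g (t + r) + g (t - r)] and [r v_t = g (t + r) - g (t - r)]:
    they give [r (u_r + |u_t|) = 1 - 2 min (g (t + r), g (t - r)) / v], and when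
    [u_r < 0] also [r (|u_r| + |u_t|) = 2 max (g (t + r), g (t - r)) / v - 1].  If
    [lo <= 2 g <= hi], then [lo <= v <= hi] as well, so that the two quantities are
    at most [1 - lo / hi] and [hi / lo - 1].  The condition on the data provides
    [lo = eps exp (- sup u0)] and [hi = data_size exp (- inf u0)], whose quotient
    [hi / lo] is [c_0].  Conversely [v(0,t) = 2 g(t)], so a bounded [u] keeps [g]
    between positive constants, and when [u0] is bounded this is the condition on
    the data. *)

(** * Calculus with directional derivatives *)

Lemma is_derive_eq (f : R -> R) (x l l' : R) :
  is_derive f x l -> l = l' -> is_derive f x l'.
Proof. now intros H <-. Qed.

Section Calculus.
Context {V : NormedModule R_AbsRing}.
Implicit Types f g : V -> R.

Definition is_dir (v : V) f (x : V) (l : R) : Prop :=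
  is_derive (fun s : R => f (plus x (scal s v))) 0 l.

Lemma line_0 (x v : V) : plus x (scal (0 : R) v) = x.
Proof. transitivity (plus x zero); [f_equal; exact (scal_zero_l v) | apply plus_zero_r]. Qed.

Lemma is_dir_unique v f x l : is_dir v f x l -> dir_deriv v f x = l.
Proof. apply is_derive_unique. Qed.

Lemma is_dir_fun v f df : (forall x, is_dir v f x (df x)) -> dir_deriv v f = df.
Proof.
  intros H. apply functional_extensionality. intros x. now apply is_dir_unique.
Qed.

Lemma C_k_continuous k f : C_k k f -> forall x, continuous f x.
Proof. destruct k; now intros [H _]. Qed.

(** Every closure property below is proved by induction on [k] through this
    criterion: exhibit all directional derivatives and show that they are [C_k]. *)
Lemma C_k_S_intro k f (df : V -> V -> R) :
  (forall x, continuous f x) ->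
  (forall v x, is_dir v f x (df v x)) ->
  (forall v, C_k k (df v)) -> C_k (S k) f.
Proof.
  intros Hc Hd HC. split; [exact Hc|]. intros v. split.
  - intros x. exists (df v x). apply Hd.
  - rewrite (is_dir_fun v f (df v)); [apply HC | apply Hd].
Qed.

Lemma C_k_S_dir k f : C_k (S k) f -> forall v x, is_dir v f x (dir_deriv v f x).
Proof. intros [_ H] v x. apply Derive_correct, (H v). Qed.

Lemma C_k_dir_deriv k f v : C_k (S k) f -> C_k k (dir_deriv v f).
Proof. intros [_ H]. apply (H v). Qed.

Lemma C_k_pred k f : C_k (S k) f -> C_k k f.
Proof.
  revert f. induction k as [|k IH]; intros f H.
  - split; [apply (C_k_continuous _ _ H) | exact I].
  - apply (C_k_S_intro k f (fun v => dir_deriv v f)).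
    + apply (C_k_continuous _ _ H).
    + apply (C_k_S_dir _ _ H).
    + intros v. apply IH, C_k_dir_deriv, H.
Qed.

Lemma smooth_dir_deriv f v : smooth f -> smooth (dir_deriv v f).
Proof. intros H k. apply C_k_dir_deriv, H. Qed.

Lemma smooth_is_dir f : smooth f -> forall v x, is_dir v f x (dir_deriv v f x).
Proof. intros H. apply (C_k_S_dir 0), H. Qed.

Lemma smooth_continuous f : smooth f -> forall x, continuous f x.
Proof. intros H. apply (C_k_continuous 0), H. Qed.

Lemma is_dir_eq v (f : V -> R) (x : V) (l l' : R) :
  is_dir v f x l -> l = l' -> is_dir v f x l'.
Proof. now intros H <-. Qed.

Lemma is_dir_affine (f : V -> R) (v x : V) (c : R) :
  (forall s, f (plus x (scal s v)) = f x + s * c) -> is_dir v f x c.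
Proof.
  intros H. apply (is_derive_ext (fun s => f x + s * c)).
  - intros s. now rewrite H.
  - auto_derive; trivial; ring.
Qed.

Lemma is_dir_const v (c : R) x : is_dir v (fun _ => c) x 0.
Proof. exact (is_derive_const (V := R_NormedModule) c 0). Qed.

Lemma is_dir_plus v f g x a b :
  is_dir v f x a -> is_dir v g x b -> is_dir v (fun y => f y + g y) x (a + b).
Proof. intros Hf Hg. exact (is_derive_plus (V := R_NormedModule) _ _ _ _ _ Hf Hg). Qed.

Lemma is_dir_mult v f g x a b :
  is_dir v f x a -> is_dir v g x b ->
  is_dir v (fun y => f y * g y) x (a * g x + f x * b).
Proof.
  intros Hf Hg. unfold is_dir.
  generalize (is_derive_mult (K := R_AbsRing) _ _ _ _ _ Hf Hg Rmult_comm).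
  now rewrite line_0.
Qed.

Lemma is_dir_comp v f x a (phi : R -> R) b :
  is_derive phi (f x) b -> is_dir v f x a -> is_dir v (fun y => phi (f y)) x (a * b).
Proof.
  intros Hphi Hf. apply (is_derive_comp phi (fun s : R => f (plus x (scal s v)))).
  - now rewrite line_0.
  - exact Hf.
Qed.

Lemma C_k_const k (c : R) : C_k k (fun _ : V => c).
Proof.
  revert c. induction k as [|k IH]; intros c.
  - split; [intros x; apply continuous_const | exact I].
  - apply (C_k_S_intro k _ (fun _ _ => 0)).
    + intros x; apply continuous_const.
    + intros v x; apply is_dir_const.
    + intros v; apply IH.
Qed.

Lemma C_k_linear k (f : V -> R) :
  (forall x, continuous f x) ->
  (forall x v s, f (plus x (scal s v)) = f x + s * f v) -> C_k k f.
Proof.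
  intros Hc Hl. destruct k as [|k]; [now split |].
  apply (C_k_S_intro k f (fun v _ => f v)); trivial.
  - intros v x. now apply is_dir_affine.
  - intros v. apply C_k_const.
Qed.

Lemma C_k_plus k f g : C_k k f -> C_k k g -> C_k k (fun x => f x + g x).
Proof.
  revert f g. induction k as [|k IH]; intros f g Hf Hg.
  all: assert (Hc : forall x, continuous (fun x => f x + g x) x)
    by (intros x; apply (continuous_plus (V := R_NormedModule) f g);
        [apply (C_k_continuous _ _ Hf) | apply (C_k_continuous _ _ Hg)]).
  - now split.
  - apply (C_k_S_intro k _ (fun v x => dir_deriv v f x + dir_deriv v g x)); trivial.
    + intros v x. apply is_dir_plus; now apply (C_k_S_dir k).
    + intros v. apply IH; now apply C_k_dir_deriv.
Qed.

Lemma C_k_mult k f g : C_k k f -> C_k k g -> C_k k (fun x => f x * g x).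
Proof.
  revert f g. induction k as [|k IH]; intros f g Hf Hg.
  all: assert (Hc : forall x, continuous (fun x => f x * g x) x)
    by (intros x; apply (continuous_mult (K := R_AbsRing) f g);
        [apply (C_k_continuous _ _ Hf) | apply (C_k_continuous _ _ Hg)]).
  - now split.
  - apply (C_k_S_intro k _ (fun v x => dir_deriv v f x * g x + f x * dir_deriv v g x));
      trivial.
    + intros v x. apply is_dir_mult; now apply (C_k_S_dir k).
    + intros v. apply C_k_plus; apply IH; trivial;
        now (apply C_k_dir_deriv || apply C_k_pred).
Qed.

Lemma C_k_scal k (c : R) f : C_k k f -> C_k k (fun x => c * f x).
Proof. intros H. apply C_k_mult; [apply C_k_const | exact H]. Qed.

Lemma C_k_opp k f : C_k k f -> C_k k (fun x => - f x).
Proof.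
  intros H. replace (fun x => - f x) with (fun x => -1 * f x).
  - now apply C_k_scal.
  - apply functional_extensionality. intros x. ring.
Qed.

Lemma C_k_exp k f : C_k k f -> C_k k (fun x => exp (f x)).
Proof.
  induction k as [|k IH]; intros Hf.
  all: assert (Hc : forall x, continuous (fun x => exp (f x)) x)
    by (intros x; apply (continuous_comp f exp);
        [apply (C_k_continuous _ _ Hf) | apply continuous_exp]).
  - now split.
  - apply (C_k_S_intro k _ (fun v x => dir_deriv v f x * exp (f x))); trivial.
    + intros v x. apply is_dir_comp; [apply is_derive_exp | now apply (C_k_S_dir k)].
    + intros v. apply C_k_mult; [now apply C_k_dir_deriv | now apply IH, C_k_pred].
Qed.

Lemma C_k_inv k f : (forall x, f x <> 0) -> C_k k f -> C_k k (fun x => / f x).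
Proof.
  intros H0. induction k as [|k IH]; intros Hf.
  all: assert (Hc : forall x, continuous (fun x => / f x) x)
    by (intros x; apply (continuous_comp f Rinv);
        [apply (C_k_continuous _ _ Hf) | now apply continuous_Rinv]).
  - now split.
  - apply (C_k_S_intro k _ (fun v x => dir_deriv v f x * (- 1 * (/ f x * / f x)))); trivial.
    + intros v x. apply is_dir_comp; [| now apply (C_k_S_dir k)].
      auto_derive; [apply H0 | field; apply H0].
    + intros v. apply C_k_mult; [now apply C_k_dir_deriv |].
      apply C_k_scal, C_k_mult; now apply IH, C_k_pred.
Qed.

Lemma is_dir_neg_ln v f x a :
  0 < f x -> is_dir v f x a -> is_dir v (fun y => - ln (f y)) x (- (a * / f x)).
Proof.
  intros Hx Hf. replace (- (a * / f x)) with (a * (- / f x)) by ring.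
  apply (is_dir_comp v f x a (fun z => - ln z)); [| exact Hf].
  auto_derive; [exact Hx | field; lra].
Qed.

(** No induction is needed: one derivative turns the logarithm into a quotient. *)
Lemma smooth_neg_ln f : (forall x, 0 < f x) -> smooth f -> smooth (fun x => - ln (f x)).
Proof.
  intros H0 Hf [|k].
  all: assert (Hc : forall x, continuous (fun x => - ln (f x)) x)
    by (intros x; apply (continuous_comp f (fun z => - ln z));
        [now apply smooth_continuous
        | apply (ex_derive_continuous (fun z => - ln z)); auto_derive; apply H0]).
  - now split.
  - apply (C_k_S_intro k _ (fun v x => - (dir_deriv v f x * / f x))); trivial.
    + intros v x. apply is_dir_neg_ln; [apply H0 | now apply smooth_is_dir].
    + intros v.
      apply C_k_opp, C_k_mult; [now apply smooth_dir_deriv |].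
      apply C_k_inv; [| apply Hf]. intros x. specialize (H0 x); lra.
Qed.

(** The quadratic term produced by the logarithm is what becomes the nonlinearity
    [u_t^2 - |grad u|^2] of the equation. *)
Lemma dir_deriv_2_neg_ln (v : V) (f : V -> R) (x : V) :
  (forall x, 0 < f x) -> smooth f ->
  dir_deriv v (dir_deriv v (fun y => - ln (f y))) x
  = - (dir_deriv v (dir_deriv v f) x / f x) + (dir_deriv v f x / f x) ^ 2.
Proof.
  intros H0 Hf.
  rewrite (is_dir_fun v (fun y => - ln (f y)) (fun x => - 1 * (dir_deriv v f x * / f x))).
  2:{ intros y. replace (-1 * (dir_deriv v f y * / f y))
        with (- (dir_deriv v f y * / f y)) by ring.
      apply (is_dir_neg_ln v f); [apply H0 | now apply smooth_is_dir]. }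
  apply is_dir_unique.
  replace (- (dir_deriv v (dir_deriv v f) x / f x) + (dir_deriv v f x / f x) ^ 2)
    with (0 * (dir_deriv v f x * / f x)
          + -1 * (dir_deriv v (dir_deriv v f) x * / f x
                  + dir_deriv v f x * (dir_deriv v f x * (- / (f x) ^ 2)))).
  2:{ field. specialize (H0 x); lra. }
  apply (is_dir_mult v (fun _ => -1) (fun x => dir_deriv v f x * / f x));
    [apply is_dir_const |].
  apply (is_dir_mult v (dir_deriv v f) (fun x => / f x)).
  - now apply smooth_is_dir, smooth_dir_deriv.
  - apply (is_dir_comp v f x _ Rinv); [| now apply smooth_is_dir].
    specialize (H0 x). auto_derive; [lra | field; lra].
Qed.

End Calculus.

(** * Smooth functions of one variable *)

Notation smooth1 := (@smooth R_NormedModule) (only parsing).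

Lemma smooth1_continuous (g : R -> R) : smooth1 g -> forall x : R, continuous g x.
Proof. intros Hg x. now apply (smooth_continuous (V := R_NormedModule)). Qed.

Lemma smooth_is_derive (g : R -> R) (x : R) : smooth1 g -> is_derive g x (Derive g x).
Proof.
  intros H. apply Derive_correct. exists (dir_deriv (V := R_NormedModule) (1 : R) g x).
  pose proof (smooth_is_dir g H (1 : R) x) as D. unfold is_dir in D.
  apply (is_derive_ext (fun y : R => g (plus x (scal (y - x) (1 : R))))).
  { intros y. f_equal. unfold plus, scal; simpl. unfold mult; simpl. ring. }
  set (l := dir_deriv _ _ _) in *. clearbody l.
  replace l with (scal (1 : R) l) by (unfold scal; simpl; apply Rmult_1_l).
  apply (is_derive_comp (fun s : R => g (plus x (scal s (1 : R)))) (fun y => y - x)).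
  - replace (x - x) with 0 by ring. exact D.
  - auto_derive; trivial; ring.
Qed.

Lemma dir_deriv_1 (g : R -> R) (c : R) :
  smooth1 g -> dir_deriv (V := R_NormedModule) c g = fun x => c * Derive g x.
Proof.
  intros H. apply (is_dir_fun (V := R_NormedModule)). intros x. unfold is_dir.
  apply (is_derive_comp g (fun s : R => plus (x : R) (scal s (c : R)))).
  - refine (eq_ind_r (fun z => is_derive g z _) _ (line_0 (V := R_NormedModule) x c)).
    now apply smooth_is_derive.
  - unfold plus, scal; simpl. unfold mult; simpl. auto_derive; trivial; ring.
Qed.

Lemma smooth_Derive (g : R -> R) : smooth1 g -> smooth1 (Derive g).
Proof.
  intros H. replace (Derive g) with (dir_deriv (V := R_NormedModule) (1 : R) g).
  - apply smooth_dir_deriv, H.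
  - rewrite (dir_deriv_1 g 1 H). apply functional_extensionality. intros x. apply Rmult_1_l.
Qed.

Lemma Derive_even (f : R -> R) (x : R) :
  smooth1 f -> (forall y, f (- y) = f y) -> Derive f (- x) = - Derive f x.
Proof.
  intros Hf E. apply is_derive_unique.
  apply (is_derive_ext (fun y => f (- y))); [exact E |].
  assert (D : is_derive f (- - x) (Derive f x)).
  { rewrite Ropp_involutive. now apply smooth_is_derive. }
  auto_derive; [eexists; exact D |].
  change (fun x : R => f x) with f. rewrite (is_derive_unique _ _ _ D). ring.
Qed.

Lemma id_smooth : smooth1 (fun s : R => s).
Proof.
  intros k. apply (C_k_linear (V := R_NormedModule)).
  - intros x; apply continuous_id.
  - reflexivity.
Qed.

(** * Weighted integrals over the interval from t - r to t + r *)

(** With weight 1 and [r > 0] this is [1 / r] times the integral of [g] over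
    [[t - r, t + r]], a radial solution of the wave equation in three dimensions;
    unlike that quotient it makes sense at [r = 0]. *)
Definition cone_int (k g : R -> R) (r t : R) : R :=
  RInt (fun s => g (t + r * s) * k s) (-1) 1.

Lemma integrand_continuous (k g a : R -> R) :
  (forall x, continuous k x) -> (forall x, continuous g x) ->
  (forall x, continuous a x) ->
  forall s : R, continuous (fun s => g (a s) * k s) s.
Proof.
  intros Hk Hg Ha s. apply (continuous_mult (K := R_AbsRing)); [| apply Hk].
  now apply (continuous_comp a g).
Qed.

Lemma affine_continuous (r t s : R) : continuous (fun s => t + r * s) s.
Proof. apply (ex_derive_continuous (fun s => t + r * s)). auto_derive; trivial. Qed.

Lemma cone_int_integrable (k g : R -> R) (r t : R) :
  (forall x, continuous k x) -> (forall x, continuous g x) ->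
  ex_RInt (fun s => g (t + r * s) * k s) (-1) 1.
Proof.
  intros Hk Hg. apply (ex_RInt_continuous (V := R_CompleteNormedModule)). intros s _.
  apply (integrand_continuous k g (fun s => t + r * s)); trivial.
  intros x. apply affine_continuous.
Qed.

Lemma RInt_linear (f h : R -> R) (a b x y : R) :
  ex_RInt f x y -> ex_RInt h x y ->
  RInt (fun s => a * f s + b * h s) x y = a * RInt f x y + b * RInt h x y.
Proof.
  intros If Ih. apply is_RInt_unique.
  apply (is_RInt_plus (V := R_NormedModule) (fun s => a * f s) (fun s => b * h s));
    apply (is_RInt_scal (V := R_NormedModule));
    now apply (RInt_correct (V := R_CompleteNormedModule)).
Qed.

Lemma cone_int_linear_weight (k1 k2 g : R -> R) (a b r t : R) :
  (forall x, continuous k1 x) -> (forall x, continuous k2 x) ->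
  (forall x, continuous g x) ->
  cone_int (fun s => a * k1 s + b * k2 s) g r t = a * cone_int k1 g r t + b * cone_int k2 g r t.
Proof.
  intros H1 H2 Hg. unfold cone_int. rewrite <- RInt_linear by now apply cone_int_integrable.
  apply RInt_ext. intros s _. match goal with |- ?x = ?y => change (x = y :> R) end. ring.
Qed.

Lemma cone_int_linear_function (k g1 g2 : R -> R) (a b r t : R) :
  (forall x, continuous k x) -> (forall x, continuous g1 x) ->
  (forall x, continuous g2 x) ->
  cone_int k (fun x => a * g1 x + b * g2 x) r t = a * cone_int k g1 r t + b * cone_int k g2 r t.
Proof.
  intros Hk H1 H2. unfold cone_int. rewrite <- RInt_linear by now apply cone_int_integrable.
  apply RInt_ext. intros s _. match goal with |- ?x = ?y => change (x = y :> R) end. ring.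
Qed.

Lemma cone_int_ext (k1 k2 g1 g2 : R -> R) (r t : R) :
  (forall s, k1 s = k2 s) -> (forall x, g1 x = g2 x) -> cone_int k1 g1 r t = cone_int k2 g2 r t.
Proof. intros H1 H2. apply RInt_ext. intros s _. now rewrite H1, H2. Qed.

(** Joint continuity: [g] is uniformly continuous on an interval containing all the
    arguments [t + r s], and [k] is bounded on [[-1, 1]]. *)
Lemma cone_int_continuous (k g : R -> R) (r t : R) :
  (forall x, continuous k x) -> (forall x, continuous g x) ->
  continuity_2d_pt (cone_int k g) r t.
Proof.
  intros Hk Hg eps.
  destruct (bounded_continuity (V := R_NormedModule) k (-1) 1) as [K HK].
  { intros x _; apply Hk. }
  assert (K0 : 0 < K).
  { eapply Rle_lt_trans; [| apply (HK 0); lra]. apply norm_ge_0. }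
  (* Margin 2 covers the arguments v + u s for all |u - r| < 1, |v - t| < 1. *)
  set (L := Rabs r + 2). pose proof (Rabs_pos r) as Hr.
  assert (He : 0 < eps / (3 * K)).
  { apply Rdiv_lt_0_compat; [apply eps | lra]. }
  destruct (unifcont_normed_1d (V := R_NormedModule) g (t - L) (t + L)
              (fun x _ => Hg x) (mkposreal _ He)) as [d Hd].
  assert (Hd1 : 0 < Rmin (d / 2) 1).
  { apply Rmin_pos; [| lra]. destruct d as [d d0]; simpl; lra. }
  exists (mkposreal _ Hd1). simpl. intros u v Hu Hv.
  pose proof (Rmin_l (d / 2) 1) as m1. pose proof (Rmin_r (d / 2) 1) as m2.
  unfold cone_int.
  rewrite <- (RInt_minus (V := R_CompleteNormedModule)
               (fun s => g (v + u * s) * k s) (fun s => g (t + r * s) * k s));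
    try now apply cone_int_integrable.
  eapply Rle_lt_trans.
  - apply (abs_RInt_le_const _ (-1) 1 (eps / (3 * K) * K)); [lra | |].
    + apply (ex_RInt_minus (V := R_NormedModule)); now apply cone_int_integrable.
    + intros s Hs. unfold minus, plus, opp; simpl.
      replace (g (v + u * s) * k s + - (g (t + r * s) * k s))
        with ((g (v + u * s) - g (t + r * s)) * k s) by ring.
      rewrite Rabs_mult. apply Rmult_le_compat; try apply Rabs_pos.
      * left. apply (Hd (t + r * s) (v + u * s)).
        -- assert (Rabs (r * s) <= Rabs r).
           { rewrite Rabs_mult. rewrite <- (Rmult_1_r (Rabs r)) at 2.
             apply Rmult_le_compat_l; trivial. apply Rabs_le; lra. }
           apply Rabs_le_between in H. unfold L; lra.
        -- assert (Rabs (u * s) <= Rabs r + 1).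
           { rewrite Rabs_mult. rewrite <- (Rmult_1_r (Rabs r + 1)).
             apply Rmult_le_compat; try apply Rabs_pos.
             - replace u with (r + (u - r)) by ring.
               eapply Rle_trans; [apply Rabs_triang | lra].
             - apply Rabs_le; lra. }
           apply Rabs_le_between in H. apply Rabs_lt_between in Hv. unfold L; lra.
        -- change (Rabs ((v + u * s) - (t + r * s)) < d).
           replace ((v + u * s) - (t + r * s)) with ((v - t) + (u - r) * s) by ring.
           eapply Rle_lt_trans; [apply Rabs_triang |].
           rewrite Rabs_mult.
           assert (Rabs (u - r) * Rabs s <= Rabs (u - r) * 1).
           { apply Rmult_le_compat_l; [apply Rabs_pos | apply Rabs_le; lra]. }
           lra.
      * left. apply (HK s). exact Hs.
  - replace ((1 - -1) * (eps / (3 * K) * K)) with (2 / 3 * eps) by (field; lra).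
    destruct eps as [e e0]; simpl; lra.
Qed.

(** Differentiation under the integral sign, for arguments affine in the parameter
    so that the derivatives in [r] and in [t] are both instances. *)
Lemma RInt_affine_derive (k g a b : R -> R) (z : R) :
  (forall x, continuous k x) -> smooth1 g ->
  (forall x, continuous a x) -> (forall x, continuous b x) ->
  is_derive (fun z => RInt (fun s => g (a s + z * b s) * k s) (-1) 1) z
    (RInt (fun s => Derive g (a s + z * b s) * (b s * k s)) (-1) 1).
Proof.
  intros Hk Hg Ha Hb.
  assert (D : forall s z, is_derive (fun z => g (a s + z * b s) * k s) z
                            (Derive g (a s + z * b s) * (b s * k s))).
  { intros s y. pose proof (smooth_is_derive g (a s + y * b s) Hg) as Dg.
    set (l := Derive g (a s + y * b s)) in *. clearbody l.
    auto_derive; [exists l; exact Dg |].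
    change (fun x : R => g x) with g. rewrite (is_derive_unique _ _ _ Dg). ring. }
  rewrite <- (RInt_ext (fun s => Derive (fun z => g (a s + z * b s) * k s) z)).
  2:{ intros s _. apply is_derive_unique, D. }
  apply (is_derive_RInt_param (fun z s => g (a s + z * b s) * k s)).
  - apply filter_forall. intros y s _. eexists; apply D.
  - intros s _.
    apply (continuity_2d_pt_ext (fun u v => Derive g (a v + u * b v) * (b v * k v))).
    { intros u v. symmetry; apply is_derive_unique, D. }
    assert (C1 : forall f : R -> R, (forall x, continuous f x) ->
                  continuity_2d_pt (fun u v : R => f v) z s).
    { intros f Hf. apply (continuity_1d_2d_pt_comp f (fun _ v => v)).
      - apply continuity_pt_filterlim, Hf.
      - apply continuity_2d_pt_id2. }
    apply continuity_2d_pt_mult; [| apply continuity_2d_pt_mult; now apply C1].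
    apply (continuity_1d_2d_pt_comp (Derive g) (fun u v => a v + u * b v)).
    + apply continuity_pt_filterlim.
      now apply smooth1_continuous, smooth_Derive.
    + apply continuity_2d_pt_plus; [now apply C1 |].
      apply continuity_2d_pt_mult; [apply continuity_2d_pt_id1 | now apply C1].
  - apply filter_forall. intros y.
    apply (ex_RInt_continuous (V := R_CompleteNormedModule)). intros s _.
    apply (integrand_continuous k g (fun s => a s + y * b s)); trivial.
    + now apply smooth1_continuous.
    + intros x. apply (continuous_plus (V := R_NormedModule)); [apply Ha |].
      apply (continuous_scal_r (V := R_NormedModule)), Hb.
Qed.

Lemma cone_int_derive_r (k g : R -> R) (r t : R) :
  (forall x, continuous k x) -> smooth1 g ->
  is_derive (fun r => cone_int k g r t) r (cone_int (fun s => s * k s) (Derive g) r t).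
Proof.
  intros Hk Hg. apply (RInt_affine_derive k g (fun _ => t) (fun s => s)); trivial.
  - intros x; apply continuous_const.
  - intros x; apply continuous_id.
Qed.

Lemma cone_int_derive_t (k g : R -> R) (r t : R) :
  (forall x, continuous k x) -> smooth1 g ->
  is_derive (fun t => cone_int k g r t) t (cone_int k (Derive g) r t).
Proof.
  intros Hk Hg. unfold cone_int.
  apply (is_derive_ext (fun z => RInt (fun s => g (r * s + z * 1) * k s) (-1) 1)).
  { intros z. apply RInt_ext. intros s _. f_equal; f_equal; ring. }
  rewrite (RInt_ext _ (fun s => Derive g (r * s + t * 1) * (1 * k s))).
  2:{ intros s _. rewrite Rmult_1_l. f_equal; f_equal; ring. }
  apply (RInt_affine_derive k g (fun s => r * s) (fun _ => 1)); trivial.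
  - intros x. apply (continuous_scal_r (V := R_NormedModule)), continuous_id.
  - intros x; apply continuous_const.
Qed.

(** The partial derivative in [r] is jointly continuous, so the integral is
    differentiable in the pair [(r, t)] and the chain rule applies. *)
Lemma cone_int_derive_path (k g rho tau : R -> R) (z dr dt : R) :
  (forall x, continuous k x) -> smooth1 g ->
  is_derive rho z dr -> is_derive tau z dt ->
  is_derive (fun z => cone_int k g (rho z) (tau z)) z
    (cone_int (fun s => s * k s) (Derive g) (rho z) (tau z) * dr
     + cone_int k (Derive g) (rho z) (tau z) * dt).
Proof.
  intros Hk Hg Hr Ht. apply is_derive_Reals.
  apply derivable_pt_lim_comp_2d; try now apply is_derive_Reals.
  apply filterdiff_differentiable_pt_lim.
  apply (is_derive_filterdiff (cone_int k g) (rho z) (tau z)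
           (fun r t => cone_int (fun s => s * k s) (Derive g) r t)).
  - apply filter_forall. intros p. now apply cone_int_derive_r.
  - now apply cone_int_derive_t.
  - apply continuity_2d_pt_filterlim, cone_int_continuous.
    + intros x. apply (continuous_mult (K := R_AbsRing)); [apply continuous_id | apply Hk].
    + now apply smooth1_continuous, smooth_Derive.
Qed.

(** Integration of the derivative of [g (t + r s) k(s)] over [-1 <= s <= 1].  The
    factor [r] comes from the inner derivative, and dividing by it is never needed,
    so the identity holds at [r = 0]. *)
Lemma cone_int_by_parts (k k' g : R -> R) (r t : R) :
  (forall s, is_derive k s (k' s)) -> (forall s, continuous k' s) -> smooth1 g ->
  r * cone_int k (Derive g) r t + cone_int k' g r t = g (t + r) * k 1 - g (t - r) * k (-1).
Proof.
  intros Hk Hk' Hg.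
  assert (Ck : forall s, continuous k s).
  { intros s. apply (ex_derive_continuous k). eexists; apply Hk. }
  pose proof (smooth1_continuous g Hg) as Cg.
  pose proof (smooth1_continuous _ (smooth_Derive g Hg)) as Cg'.
  unfold cone_int.
  rewrite <- (RInt_scal (V := R_CompleteNormedModule) (fun s => Derive g (t + r * s) * k s)).
  2:{ now apply cone_int_integrable. }
  rewrite <- (RInt_plus (V := R_CompleteNormedModule)
    (fun s => scal r (Derive g (t + r * s) * k s)) (fun s => g (t + r * s) * k' s)).
  2:{ now apply (ex_RInt_scal (V := R_NormedModule)), cone_int_integrable. }
  2:{ now apply cone_int_integrable. }
  replace (t + r) with (t + r * 1) by ring. replace (t - r) with (t + r * -1) by ring.
  apply is_RInt_unique.
  apply (is_RInt_derive (V := R_CompleteNormedModule) (fun s => g (t + r * s) * k s)).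
  - intros s _. pose proof (smooth_is_derive g (t + r * s) Hg) as Dg.
    pose proof (Hk s) as Dk.
    set (l := Derive g (t + r * s)) in *. clearbody l.
    auto_derive; [split; [eexists; exact Dg | split; [eexists; exact Dk | trivial]] |].
    change (fun x : R => g x) with g. change (fun x : R => k x) with k.
    rewrite (is_derive_unique _ _ _ Dk), (is_derive_unique _ _ _ Dg).
    unfold plus, scal; simpl. unfold mult; simpl. ring.
  - intros s _.
    apply (continuous_plus (V := R_NormedModule)).
    + apply (continuous_scal_r (V := R_NormedModule)).
      apply (integrand_continuous k (Derive g) (fun s => t + r * s)); trivial.
      intros x; apply affine_continuous.
    + apply (integrand_continuous k' g (fun s => t + r * s)); trivial.
      intros x; apply affine_continuous.
Qed.

Lemma RInt_reflect (f : R -> R) :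
  ex_RInt f (-1) 1 -> RInt (fun s => f (- s)) (-1) 1 = RInt f (-1) 1.
Proof.
  intros H. apply ex_RInt_swap in H.
  rewrite <- (opp_RInt_swap (V := R_CompleteNormedModule) f 1 (-1) H).
  pose proof (RInt_comp_lin (V := R_CompleteNormedModule) f (-1) 0 (-1) 1) as E.
  replace (-1 * -1 + 0) with 1 in E by ring. replace (-1 * 1 + 0) with (-1) in E by ring.
  rewrite <- (E H).
  rewrite (RInt_scal (V := R_CompleteNormedModule) (fun y => f (-1 * y + 0))).
  - unfold scal, opp; simpl. unfold mult; simpl.
    rewrite (RInt_ext (fun s => f (- s)) (fun y => f (-1 * y + 0))).
    { assert (E1 : forall z : R, z = - (-1 * z)) by (intros; ring). apply E1. }
    intros s _. f_equal; ring.
  - apply (ex_RInt_ext (fun y => scal (-1) (scal (-1) (f (-1 * y + 0))))).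
    + intros y _. unfold scal; simpl. unfold mult; simpl. ring.
    + apply (ex_RInt_scal (V := R_NormedModule)).
      apply (ex_RInt_comp_lin (V := R_NormedModule) f (-1) 0).
      replace (-1 * -1 + 0) with 1 by ring. now replace (-1 * 1 + 0) with (-1) by ring.
Qed.

Lemma cone_int_even (k g : R -> R) (r t : R) :
  (forall s, k (- s) = k s) -> (forall x, continuous k x) -> (forall x, continuous g x) ->
  cone_int k g (- r) t = cone_int k g r t.
Proof.
  intros Ek Hk Hg. unfold cone_int.
  rewrite <- (RInt_reflect (fun s => g (t + r * s) * k s)) by now apply cone_int_integrable.
  apply RInt_ext. intros s _. rewrite Ek. f_equal; f_equal; ring.
Qed.

(** * Radial solutions of the linear wave equation *)

Definition weight (j : nat) (s : R) : R := (1 - s ^ 2) ^ j.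

Lemma weight_derive (j : nat) (s : R) :
  is_derive (weight (S j)) s (- (2 * (INR j + 1)) * (s * weight j s)).
Proof.
  unfold weight. auto_derive; trivial.
  change (Nat.pred (S j)) with j.
  change (match j with 0%nat => 1 | S _ => INR j + 1 end) with (INR (S j)).
  rewrite <- S_INR.
  replace (s * (s * 1)) with (s ^ 2) by ring. unfold Rminus. ring.
Qed.

Lemma weight_continuous (j : nat) (s : R) : continuous (weight j) s.
Proof.
  apply (ex_derive_continuous (weight j)). unfold weight. auto_derive; trivial.
Qed.

Lemma s_weight_continuous (j : nat) (s : R) : continuous (fun s => s * weight j s) s.
Proof.
  apply (continuous_mult (K := R_AbsRing)); [apply continuous_id | apply weight_continuous].
Qed.

(** Integration by parts of the weight: the boundary terms vanish as
    [(1 - s^2)^(j + 1)] does at both ends.  It replaces the odd weight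
    [s (1 - s^2)^j] of the [r]-derivative by an explicit factor [r]. *)
Lemma cone_int_weight_S (j : nat) (g : R -> R) (r t : R) : smooth1 g ->
  r * cone_int (weight (S j)) (Derive g) r t
  = 2 * (INR j + 1) * cone_int (fun s => s * weight j s) g r t.
Proof.
  intros Hg. pose proof (smooth1_continuous g Hg) as Cg.
  pose proof (s_weight_continuous j) as Cw.
  set (w := fun s => s * weight j s) in *. set (c := - (2 * (INR j + 1))).
  assert (E : r * cone_int (weight (S j)) (Derive g) r t
              + cone_int (fun s => c * w s + 0 * w s) g r t
              = g (t + r) * weight (S j) 1 - g (t - r) * weight (S j) (-1)).
  { apply cone_int_by_parts; trivial.
    - intros s. eapply is_derive_eq; [apply weight_derive | unfold c, w; ring].
    - intros s. apply (continuous_plus (V := R_NormedModule));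
        apply (continuous_scal_r (V := R_NormedModule)), Cw. }
  rewrite cone_int_linear_weight in E by trivial.
  replace (weight (S j) 1) with 0 in E by (unfold weight; simpl; ring).
  replace (weight (S j) (-1)) with 0 in E by (unfold weight; simpl; ring).
  unfold c in E. lra.
Qed.

(** The wave equation in radial form.  Two integrations by parts move the two
    derivatives of [g] onto the weight [(1 - s^2)^2 / 8], whose second derivative
    is [(3 s^2 - 1) / 2], and [1 = 3/2 (1 - s^2) + (3 s^2 - 1) / 2]. *)
Lemma cone_int_wave_identity (g : R -> R) (r t : R) : smooth1 g ->
  cone_int (weight 0) g r t
  = 3 / 2 * cone_int (weight 1) g r t
    + r ^ 2 / 8 * cone_int (weight 2) (Derive (Derive g)) r t.
Proof.
  intros Hg. pose proof (smooth1_continuous g Hg) as Cg.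
  pose proof (cone_int_weight_S 1 (Derive g) r t (smooth_Derive g Hg)) as E2.
  simpl INR in E2.
  assert (E : r * cone_int (fun s => s * weight 1 s) (Derive g) r t
              + cone_int (fun s => 3 * weight 1 s + -2 * weight 0 s) g r t
              = g (t + r) * (1 * weight 1 1) - g (t - r) * (-1 * weight 1 (-1))).
  { apply (cone_int_by_parts (fun s => s * weight 1 s)); trivial.
    - intros s. unfold weight. auto_derive; trivial. simpl; ring.
    - intros s. apply (continuous_plus (V := R_NormedModule));
        apply (continuous_scal_r (V := R_NormedModule)), weight_continuous. }
  rewrite cone_int_linear_weight in E; trivial; try apply weight_continuous.
  replace (weight 1 1) with 0 in E by (unfold weight; ring).
  replace (weight 1 (-1)) with 0 in E by (unfold weight; ring).
  replace (r ^ 2 / 8 * cone_int (weight 2) (Derive (Derive g)) r t)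
    with (r / 8 * (r * cone_int (weight 2) (Derive (Derive g)) r t)) by field.
  rewrite E2. lra.
Qed.

Lemma norm_space (a b c : R) : norm ((a, b, c) : space) = sqrt (a ^ 2 + b ^ 2 + c ^ 2).
Proof.
  change (sqrt (sqrt (Rabs a ^ 2 + Rabs b ^ 2) ^ 2 + Rabs c ^ 2)
          = sqrt (a ^ 2 + b ^ 2 + c ^ 2)).
  rewrite !pow2_abs, pow2_sqrt; trivial. nra.
Qed.

Definition dot (x y : space) : R :=
  fst (fst x) * fst (fst y) + snd (fst x) * snd (fst y) + snd x * snd y.

Definition wave (j : nat) (g : R -> R) (p : spacetime) : R :=
  cone_int (weight j) g (norm (fst p)) (snd p).

Lemma weight_even (j : nat) (s : R) : weight j (- s) = weight j s.
Proof. unfold weight. f_equal. ring. Qed.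

Lemma cone_int_weight_abs (j : nat) (g : R -> R) (r t : R) : smooth1 g ->
  cone_int (weight j) g (Rabs r) t = cone_int (weight j) g r t.
Proof.
  intros Hg. unfold Rabs. destruct (Rcase_abs r); trivial.
  apply cone_int_even; [apply weight_even | apply weight_continuous |].
  now apply smooth1_continuous.
Qed.

(** For [x <> 0] this is the chain rule through [|x + s y|], with the factor [r]
    of [cone_int_weight_S] cancelling the denominator of [x.y / |x|].  At [x = 0] the
    path is [|s| |y|], and evenness in [r] replaces it by the smooth path [s |y|]. *)
Lemma wave_is_dir (j : nat) (g : R -> R) (x y : space) (t tau : R) : smooth1 g ->
  is_dir ((y, tau) : spacetime) (wave j g) (x, t)
    (dot x y * (/ (2 * (INR j + 1)) * wave (S j) (Derive (Derive g)) (x, t))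
     + tau * wave j (Derive g) (x, t)).
Proof.
  intros Hg. pose proof (smooth_Derive g Hg) as Hg'.
  pose proof (cone_int_weight_S j (Derive g) (norm x) t Hg') as E.
  assert (J : 0 < INR j + 1) by (pose proof (pos_INR j); lra).
  destruct x as [[a b] c]. destruct y as [[a' b'] c'].
  unfold is_dir, wave, dot. simpl fst. simpl snd.
  assert (Dt : is_derive (fun s => t + s * tau) 0 tau) by (auto_derive; trivial; ring).
  assert (N : forall s : R,
    norm (fst (plus (((a, b, c), t) : spacetime) (scal s (((a', b', c'), tau) : spacetime))))
    = sqrt ((a + s * a') ^ 2 + (b + s * b') ^ 2 + (c + s * c') ^ 2)).
  { intros s. apply norm_space. }
  assert (N' : forall s r : R,
    sqrt ((a + s * a') ^ 2 + (b + s * b') ^ 2 + (c + s * c') ^ 2) = r ->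
    cone_int (weight j) g r (t + s * tau)
    = wave j g (plus (((a, b, c), t) : spacetime) (scal s (((a', b', c'), tau) : spacetime)))).
  { intros s r Hr. unfold wave. rewrite <- Hr, <- N. reflexivity. }
  rewrite norm_space in E |- *.
  set (q := a ^ 2 + b ^ 2 + c ^ 2) in *.
  destruct (Req_dec q 0) as [q0 | q0].
  - assert (a = 0 /\ b = 0 /\ c = 0) as (a0 & b0 & c0) by (unfold q in q0; nra).
    subst a b c.
    set (L := sqrt (a' ^ 2 + b' ^ 2 + c' ^ 2)).
    apply (is_derive_ext (fun s => cone_int (weight j) g (s * L) (t + s * tau))).
    { intros s. rewrite <- (cone_int_weight_abs j g (s * L)) by trivial. apply N'.
      symmetry. unfold L. rewrite Rabs_mult, (Rabs_pos_eq (sqrt _)) by apply sqrt_pos.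
      rewrite <- sqrt_Rsqr_abs, <- sqrt_mult_alt by apply Rle_0_sqr.
      f_equal. unfold Rsqr. ring. }
    assert (D := cone_int_derive_path (weight j) g (fun s => s * L) (fun s => t + s * tau)
                   0 L tau (weight_continuous j) Hg).
    cbv beta in D. rewrite q0, sqrt_0 in *.
    replace (0 * L) with 0 in D by ring. replace (t + 0 * tau) with t in D by ring.
    replace (cone_int (fun s => s * weight j s) (Derive g) 0 t) with 0 in D by nra.
    eapply is_derive_eq; [apply D | ring]; trivial.
    auto_derive; trivial; ring.
  - assert (0 < q) by (unfold q in *; nra).
    assert (S0 : 0 < sqrt q) by now apply sqrt_lt_R0.
    set (rho := fun s => sqrt ((a + s * a') ^ 2 + (b + s * b') ^ 2 + (c + s * c') ^ 2)).
    assert (R0 : rho 0 = sqrt q) by (unfold rho, q; f_equal; ring).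
    apply (is_derive_ext (fun s => cone_int (weight j) g (rho s) (t + s * tau))).
    { intros s. now apply N'. }
    assert (D := cone_int_derive_path (weight j) g rho (fun s => t + s * tau)
                   0 ((a * a' + b * b' + c * c') / sqrt q) tau (weight_continuous j) Hg).
    cbv beta in D. rewrite R0 in D. replace (t + 0 * tau) with t in D by ring.
    eapply is_derive_eq; [apply D |]; trivial.
    + unfold rho. auto_derive.
      * unfold q in *. nra.
      * match goal with |- context [sqrt ?X] => lazymatch X with q => fail | _ =>
          replace X with q by (unfold q; ring) end end. field. lra.
    + replace (cone_int (fun s => s * weight j s) (Derive g) (sqrt q) t)
        with (/ (2 * (INR j + 1))
              * (sqrt q * cone_int (weight (S j)) (Derive (Derive g)) (sqrt q) t)).
      * field; split; lra.
      * rewrite E. field; lra.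
Qed.

Lemma wave_continuous (j : nat) (g : R -> R) (p : spacetime) :
  smooth1 g -> continuous (wave j g) p.
Proof.
  intros Hg.
  apply (continuous_comp_2 (fun p : spacetime => norm (fst p)) (fun p : spacetime => snd p)
           (cone_int (weight j) g)).
  - apply (continuous_comp (fun p : spacetime => fst p) (fun x : space => norm x)).
    + destruct p; apply continuous_fst.
    + apply (filterlim_norm (V := space)).
  - destruct p; apply continuous_snd.
  - apply continuity_2d_pt_filterlim, cone_int_continuous; [apply weight_continuous |].
    now apply smooth1_continuous.
Qed.

Definition coord1 (p : spacetime) : R := fst (fst (fst p)).
Definition coord2 (p : spacetime) : R := snd (fst (fst p)).
Definition coord3 (p : spacetime) : R := snd (fst p).

Lemma coordinate_smooth : smooth coord1 /\ smooth coord2 /\ smooth coord3.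
Proof.
  assert (C : forall p : spacetime, continuous (fun p : spacetime => fst p) p)
    by (intros [x t]; apply continuous_fst).
  assert (C' : forall p : spacetime, continuous (fun p : spacetime => fst (fst p)) p).
  { intros p. apply (continuous_comp (fun p : spacetime => fst p) (fun x : space => fst x));
    [apply C | destruct p as [[y c] t]; apply continuous_fst]. }
  repeat split; intros k; apply C_k_linear; try reflexivity.
  - intros p. apply (continuous_comp (fun p : spacetime => fst (fst p)) (fun x => fst x)).
    + apply C'.
    + destruct p as [[[a b] c] t]. apply continuous_fst.
  - intros p. apply (continuous_comp (fun p : spacetime => fst (fst p)) (fun x => snd x)).
    + apply C'.
    + destruct p as [[[a b] c] t]. apply continuous_snd.
  - intros p. apply (continuous_comp (fun p : spacetime => fst p) (fun x => snd x)).
    + apply C.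
    + destruct p as [[y c] t]. apply continuous_snd.
Qed.

(** The induction is on [k] for all [j] and [g] at once: each derivative raises [j]
    and differentiates [g]. *)
Lemma wave_C_k (k j : nat) (g : R -> R) : smooth1 g -> C_k k (wave j g).
Proof.
  revert j g. induction k as [|k IH]; intros j g Hg.
  - split; [intros p; now apply wave_continuous | exact I].
  - pose proof (smooth_Derive g Hg) as Hg'. pose proof (smooth_Derive _ Hg') as Hg''.
    apply (C_k_S_intro k _ (fun v p =>
      dot (fst p) (fst v) * (/ (2 * (INR j + 1)) * wave (S j) (Derive (Derive g)) p)
      + snd v * wave j (Derive g) p)).
    + intros p; now apply wave_continuous.
    + intros [y tau] [x t]. now apply wave_is_dir.
    + intros [[[a b] c] tau]. simpl. apply C_k_plus; apply C_k_mult.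
      * destruct coordinate_smooth as (S1 & S2 & S3).
        repeat apply C_k_plus; apply C_k_mult; try apply C_k_const;
          [apply S1 | apply S2 | apply S3].
      * now apply C_k_scal, IH.
      * apply C_k_const.
      * now apply IH.
Qed.

Lemma dt_wave (j : nat) (g : R -> R) : smooth1 g -> dt (wave j g) = wave j (Derive g).
Proof.
  intros Hg. apply is_dir_fun. intros [x t].
  eapply is_dir_eq; [now apply wave_is_dir |].
  unfold dot; simpl. ring.
Qed.

Lemma dx_wave (e : space) (j : nat) (g : R -> R) : smooth1 g ->
  dx e (wave j g)
  = fun p => dot (fst p) e * (/ (2 * (INR j + 1)) * wave (S j) (Derive (Derive g)) p).
Proof.
  intros Hg. apply is_dir_fun. intros [x t].
  eapply is_dir_eq; [now apply wave_is_dir |].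
  simpl. ring.
Qed.

Lemma dx_dx_wave (e : space) (g : R -> R) (p : spacetime) : smooth1 g ->
  dx e (dx e (wave 0 g)) p
  = dot e e * (/ 2 * wave 1 (Derive (Derive g)) p)
    + dot (fst p) e
      * (/ 2 * (dot (fst p) e * (/ 4 * wave 2 (Derive (Derive (Derive (Derive g)))) p))).
Proof.
  intros Hg. assert (Hg2 : smooth1 (Derive (Derive g))) by now do 2 apply smooth_Derive.
  rewrite dx_wave by trivial. destruct p as [x t].
  unfold dx. apply is_dir_unique.
  replace (2 * (INR 0 + 1)) with 2 by (simpl; ring).
  apply (is_dir_mult _ (fun p : spacetime => dot (fst p) e)
          (fun p => / 2 * wave 1 (Derive (Derive g)) p)).
  - apply is_dir_affine. intros s. destruct x as [[a b] c], e as [[a' b'] c'].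
    unfold dot; simpl. unfold plus, scal; simpl. unfold plus, scal; simpl. unfold mult; simpl. ring.
  - eapply is_dir_eq.
    + apply (is_dir_mult _ (fun _ => / 2) (wave 1 (Derive (Derive g))));
        [apply is_dir_const | now apply wave_is_dir].
    + simpl. replace (2 * (1 + 1)) with 4 by ring. ring.
Qed.

Lemma wave_solves_linear (g : R -> R) (p : spacetime) : smooth1 g ->
  dt (dt (wave 0 g)) p = laplacian (wave 0 g) p.
Proof.
  intros Hg. assert (Hg2 : smooth1 (Derive (Derive g))) by now do 2 apply smooth_Derive.
  unfold laplacian. rewrite !dx_dx_wave by trivial.
  rewrite !dt_wave by (try apply smooth_Derive; trivial).
  destruct p as [[[a b] c] t]. unfold wave at 1. simpl fst; simpl snd.
  rewrite cone_int_wave_identity by trivial.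
  rewrite norm_space, pow2_sqrt by nra.
  unfold wave; simpl fst; simpl snd. rewrite norm_space.
  unfold dot; simpl. field.
Qed.

(** * Profiles of radial functions *)

Lemma pair_0_continuous (U W : UniformSpace) (f : U -> W) (c : R) (x : U) :
  continuous f x -> continuous (fun y => (f y, c)) x.
Proof.
  intros Hf P [eps HP].
  unfold filtermap. apply (filter_imp (F := locally x) (fun y => ball (f x) eps (f y))).
  - intros y Hy. apply HP. split; [exact Hy | apply ball_center].
  - exact (proj1 (filterlim_locally _ _) Hf eps).
Qed.

Lemma axis_continuous (x : R) : continuous (fun r : R => (r, 0, 0) : space) x.
Proof.
  apply (pair_0_continuous R_UniformSpace (prod_UniformSpace R_UniformSpace R_UniformSpace)
           (fun r : R => (r, 0))).
  apply (pair_0_continuous R_UniformSpace R_UniformSpace (fun r : R => r)).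
  apply continuous_id.
Qed.

Lemma C_k_profile (k : nat) (f : space -> R) :
  C_k k f -> C_k (V := R_NormedModule) k (profile f).
Proof.
  assert (L : forall x s y : R,
    ((plus x (scal s y), 0, 0) : space) = plus ((x, 0, 0) : space) (scal s ((y, 0, 0) : space))).
  { intros x s y.
    change ((x + s * y, 0, 0) = (x + s * y, 0 + s * 0, 0 + s * 0)).
    now replace (0 + s * 0) with 0 by ring. }
  revert f. induction k as [|k IH]; intros f Hf.
  all: assert (Hc : forall x : R, continuous (profile f) x).
  1, 3: intros x; apply (continuous_comp (fun r : R => (r, 0, 0) : space) f);
        [apply axis_continuous | apply (C_k_continuous _ _ Hf)].
  - now split.
  - apply (C_k_S_intro (V := R_NormedModule) k _
             (fun y => profile (dir_deriv ((y, 0, 0) : space) f))); trivial.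
    + intros y x. unfold is_dir.
      apply (is_derive_ext (fun s : R =>
               f (plus ((x, 0, 0) : space) (scal s ((y, 0, 0) : space))))).
      * intros s. unfold profile. now rewrite <- L.
      * now apply (C_k_S_dir k).
    + intros y. now apply IH, C_k_dir_deriv.
Qed.

Lemma profile_smooth (f : space -> R) : smooth f -> smooth1 (profile f).
Proof. intros Hf k. apply C_k_profile, Hf. Qed.

Lemma profile_even (f : space -> R) : radial f -> forall r, profile f (- r) = profile f r.
Proof.
  intros Hf r. apply Hf. rewrite !norm_space. f_equal. ring.
Qed.

Lemma norm_axis (r : R) : norm ((r, 0, 0) : space) = Rabs r.
Proof.
  rewrite norm_space. replace (r ^ 2 + 0 ^ 2 + 0 ^ 2) with (Rsqr r) by (unfold Rsqr; ring).
  apply sqrt_Rsqr_abs.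
Qed.

Lemma norm_nonneg (x : space) : 0 <= norm x.
Proof. apply (norm_ge_0 (V := space)). Qed.

Lemma radial_profile (f : space -> R) : radial f -> forall x, f x = profile f (norm x).
Proof.
  intros Hf x. apply Hf. rewrite norm_axis. symmetry. apply Rabs_pos_eq, norm_nonneg.
Qed.

(** * Values and bounds of the unweighted integral *)

Lemma weight_0 (s : R) : weight 0 s = 1.
Proof. reflexivity. Qed.

Lemma cone_int_odd (g : R -> R) (r : R) :
  (forall x, continuous g x) -> (forall x, g (- x) = - g x) -> cone_int (weight 0) g r 0 = 0.
Proof.
  intros Hg Eg.
  assert (E : cone_int (weight 0) g (- r) 0 = - cone_int (weight 0) g r 0).
  { unfold cone_int.
    rewrite (RInt_ext _ (fun s => opp (g (0 + r * s) * weight 0 s))).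
    - apply (RInt_opp (V := R_CompleteNormedModule)).
      apply cone_int_integrable; trivial; apply weight_continuous.
    - intros s _. replace (0 + - r * s) with (- (0 + r * s)) by ring.
      rewrite Eg. unfold opp; simpl. ring. }
  rewrite (cone_int_even _ _ _ _ (weight_even 0) (weight_continuous 0) Hg) in E. lra.
Qed.

(** [q + x q'] is the derivative of [x q(x)], and [s q(r s)] is an antiderivative in
    [s] of its value at [r s]. *)
Lemma cone_int_derive_id_mult (q : R -> R) (r : R) : smooth1 q ->
  cone_int (weight 0) (fun x => q x + x * Derive q x) r 0 = q r + q (- r).
Proof.
  intros Hq. pose proof (smooth1_continuous q Hq) as Cq.
  pose proof (smooth1_continuous _ (smooth_Derive q Hq)) as Cq'.
  assert (Cx : forall x : R, continuous (fun x => x * Derive q x) x).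
  { intros x. apply (continuous_mult (K := R_AbsRing)); [apply continuous_id | apply Cq']. }
  rewrite (cone_int_ext (weight 0) (weight 0) _ (fun x => 1 * q x + 1 * (x * Derive q x)));
    trivial; try (intros; ring).
  rewrite cone_int_linear_function; trivial; try apply weight_continuous.
  assert (E : cone_int (weight 0) (fun x => x * Derive q x) r 0
              = r * cone_int (fun s => s) (Derive q) r 0).
  { unfold cone_int.
    rewrite <- (RInt_scal (V := R_CompleteNormedModule) (fun s => Derive q (0 + r * s) * s)).
    - apply RInt_ext. intros s _. rewrite weight_0. unfold scal; simpl. unfold mult; simpl. ring.
    - apply cone_int_integrable; trivial. intros x; apply continuous_id. }
  rewrite E.
  assert (P : r * cone_int (fun s => s) (Derive q) r 0 + cone_int (weight 0) q r 0
              = q (0 + r) * 1 - q (0 - r) * -1).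
  { apply cone_int_by_parts; trivial; [| apply weight_continuous].
    intros s. rewrite weight_0. auto_derive; trivial. }
  rewrite Rplus_0_l, Rminus_0_l in P.
  lra.
Qed.

(** With [v] the integral of [g] this reads [r v_r + v = g (t + r) + g (t - r)]. *)
Lemma cone_int_r_derivative (g : R -> R) (r t : R) : smooth1 g ->
  r * cone_int (fun s => s * weight 0 s) (Derive g) r t + cone_int (weight 0) g r t
  = g (t + r) + g (t - r).
Proof.
  intros Hg. rewrite cone_int_by_parts; trivial.
  - rewrite !weight_0. ring.
  - intros s. apply (is_derive_ext (fun s => s)).
    + intros y. rewrite weight_0. symmetry. apply Rmult_1_r.
    + rewrite weight_0. auto_derive; trivial.
  - apply weight_continuous.
Qed.

(** With [v] the integral of [g] this reads [r v_t = g (t + r) - g (t - r)]. *)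
Lemma cone_int_t_derivative (g : R -> R) (r t : R) : smooth1 g ->
  r * cone_int (weight 0) (Derive g) r t = g (t + r) - g (t - r).
Proof.
  intros Hg. pose proof (cone_int_by_parts (weight 0) (fun _ => 0) g r t) as P.
  rewrite !weight_0 in P. rewrite <- (Rmult_1_r (g (t + r))), <- (Rmult_1_r (g (t - r))).
  rewrite <- P; trivial.
  - assert (Z : cone_int (fun _ => 0) g r t = 0).
    { unfold cone_int. rewrite (RInt_ext _ (fun _ => 0)) by (intros s _; apply Rmult_0_r).
      rewrite RInt_const. unfold scal; simpl. unfold mult; simpl. ring. }
    rewrite Z. ring.
  - intros s. apply (is_derive_const (V := R_NormedModule) 1).
  - intros s. apply continuous_const.
Qed.

Lemma cone_int_at_0 (g : R -> R) (t : R) : cone_int (weight 0) g 0 t = 2 * g t.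
Proof.
  unfold cone_int. rewrite (RInt_ext _ (fun _ => g t)).
  - rewrite RInt_const. unfold scal; simpl. unfold mult; simpl. ring.
  - intros s _. rewrite weight_0, Rmult_0_l, Rplus_0_r. apply Rmult_1_r.
Qed.

Lemma cone_int_ge (g : R -> R) (c r t : R) :
  (forall x, continuous g x) -> (forall s, c <= g s) -> 2 * c <= cone_int (weight 0) g r t.
Proof.
  intros Hg Hc. replace (2 * c) with (RInt (fun _ => c) (-1) 1).
  2:{ rewrite RInt_const. unfold scal; simpl. unfold mult; simpl. ring. }
  apply RInt_le; [lra | apply ex_RInt_const | |].
  - apply cone_int_integrable; trivial. apply weight_continuous.
  - intros s _. rewrite weight_0, Rmult_1_r. apply Hc.
Qed.

Lemma cone_int_le (g : R -> R) (c r t : R) :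
  (forall x, continuous g x) -> (forall s, g s <= c) -> cone_int (weight 0) g r t <= 2 * c.
Proof.
  intros Hg Hc. replace (2 * c) with (RInt (fun _ => c) (-1) 1).
  2:{ rewrite RInt_const. unfold scal; simpl. unfold mult; simpl. ring. }
  apply RInt_le; [lra | | apply ex_RInt_const |].
  - apply cone_int_integrable; trivial. apply weight_continuous.
  - intros s _. rewrite weight_0, Rmult_1_r. apply Hc.
Qed.

Lemma cone_int_pos (g : R -> R) (r t : R) :
  (forall x, continuous g x) -> (forall s, 0 < g s) -> 0 < cone_int (weight 0) g r t.
Proof.
  intros Hg Hc. apply RInt_gt_0; [lra | |].
  - intros s _. rewrite weight_0, Rmult_1_r. apply Hc.
  - intros s _. apply (integrand_continuous (weight 0) g (fun s => t + r * s)); trivial.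
    + apply weight_continuous.
    + intros x; apply affine_continuous.
Qed.

(** * The density of the wave *)

(** Half of [w0' + w1], where [w0 = s exp (- p0)] and [w1 = - s p1 exp (- p0)] are the
    Cauchy data of [r v] for the wave equation on the line (d'Alembert). *)
Definition density (p0 p1 : R -> R) (s : R) : R :=
  / 2 * (exp (- p0 s) * (1 - s * Derive p0 s - s * p1 s)).

Section Density.
Variables p0 p1 : R -> R.
Hypothesis p0_smooth : smooth1 p0.
Hypothesis p1_smooth : smooth1 p1.
Hypothesis p0_even : forall s, p0 (- s) = p0 s.
Hypothesis p1_even : forall s, p1 (- s) = p1 s.

Let a (s : R) := exp (- p0 s).
Let q (s : R) := p1 s * a s.

Lemma exp_opp_smooth : smooth1 (fun s => exp (- p0 s)).
Proof.
  intros k. apply (C_k_exp (V := R_NormedModule)), (C_k_opp (V := R_NormedModule)), p0_smooth.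
Qed.

Lemma q_smooth : smooth1 q.
Proof.
  intros k. apply (C_k_mult (V := R_NormedModule)); [apply p1_smooth | apply exp_opp_smooth].
Qed.

Lemma Derive_exp_opp (s : R) : Derive a s = - Derive p0 s * exp (- p0 s).
Proof.
  apply is_derive_unique. unfold a.
  pose proof (smooth_is_derive p0 s p0_smooth) as D.
  auto_derive; [eexists; exact D |].
  change (fun x : R => p0 x) with p0. ring.
Qed.

Lemma moment_smooth (f : R -> R) : smooth1 f -> smooth1 (fun s => f s + s * Derive f s).
Proof.
  intros Hf k. apply (C_k_plus (V := R_NormedModule)); [apply Hf |].
  apply (C_k_mult (V := R_NormedModule)); [apply id_smooth | now apply smooth_Derive].
Qed.

(** The even part is the derivative of [s a(s)] and the odd part is [s q(s)]; the
    initial values below see one part each, by parity. *)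
Lemma density_split :
  density p0 p1 = fun s => / 2 * (a s + s * Derive a s) + - / 2 * (s * q s).
Proof.
  apply functional_extensionality. intros s.
  rewrite Derive_exp_opp. unfold density, q, a. ring.
Qed.

Lemma id_q_smooth : smooth1 (fun s => s * q s).
Proof.
  intros k. apply (C_k_mult (V := R_NormedModule)); [apply id_smooth | apply q_smooth].
Qed.

Lemma density_smooth : smooth1 (density p0 p1).
Proof.
  rewrite density_split. intros k.
  apply (C_k_plus (V := R_NormedModule)); apply (C_k_scal (V := R_NormedModule)).
  - apply moment_smooth, exp_opp_smooth.
  - apply id_q_smooth.
Qed.

Lemma a_even (s : R) : a (- s) = a s.
Proof. unfold a. now rewrite p0_even. Qed.

Lemma q_even (s : R) : q (- s) = q s.
Proof. unfold q. now rewrite a_even, p1_even. Qed.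

Lemma density_cone_int_0 (r : R) : cone_int (weight 0) (density p0 p1) r 0 = exp (- p0 r).
Proof.
  rewrite density_split, cone_int_linear_function.
  - rewrite cone_int_derive_id_mult by apply exp_opp_smooth.
    rewrite cone_int_odd, a_even; [unfold a; field | | ].
    + apply smooth1_continuous, id_q_smooth.
    + intros x. rewrite q_even. ring.
  - apply weight_continuous.
  - apply smooth1_continuous, moment_smooth, exp_opp_smooth.
  - apply smooth1_continuous, id_q_smooth.
Qed.

Lemma Derive_density_cone_int_0 (r : R) :
  cone_int (weight 0) (Derive (density p0 p1)) r 0 = - p1 r * exp (- p0 r).
Proof.
  set (A := fun s => a s + s * Derive a s).
  assert (SA : smooth1 A) by apply moment_smooth, exp_opp_smooth.
  rewrite (cone_int_ext (weight 0) (weight 0) _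
             (fun s => / 2 * Derive A s + - / 2 * (q s + s * Derive q s))); trivial.
  - rewrite cone_int_linear_function.
    + rewrite cone_int_derive_id_mult by apply q_smooth.
      rewrite cone_int_odd, q_even; [unfold q, a; field | |].
      * now apply smooth1_continuous, smooth_Derive.
      * intros x. apply Derive_even; trivial.
        intros y. unfold A. rewrite a_even, (Derive_even a); [ring | | apply a_even].
        apply exp_opp_smooth.
    + apply weight_continuous.
    + now apply smooth1_continuous, smooth_Derive.
    + apply smooth1_continuous, moment_smooth, q_smooth.
  - intros s. rewrite density_split. apply is_derive_unique.
    pose proof (smooth_is_derive A s SA) as DA.
    pose proof (smooth_is_derive q s q_smooth) as Dq.
    change (is_derive (fun s => / 2 * A s + - / 2 * (s * q s)) s
              (/ 2 * Derive A s + - / 2 * (q s + s * Derive q s))).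
    clearbody A q.
    auto_derive; [split; [eexists; exact DA | split; [eexists; exact Dq | trivial]] |].
    change (fun x : R => A x) with A. change (fun x : R => q x) with q. ring.
Qed.

(** On negative [s] the even extension of [p0] reverses the sign of its derivative,
    so that only the term with [p1] remembers the sign of [s]. *)
Lemma density_abs (s : R) :
  2 * density p0 p1 s
  = exp (- p0 s) * (1 - Rabs s * Derive p0 (Rabs s) - s * p1 s).
Proof.
  unfold density, Rabs. destruct (Rcase_abs s).
  - rewrite (Derive_even p0) by trivial. field.
  - field.
Qed.

End Density.

(** * Suprema and one-sided limits *)

Lemma sup_fun_ub {T : Type} (f : T -> R) (x : T) : bounded_fun f -> f x <= sup_fun f.
Proof.
  intros [M HM]. unfold sup_fun.
  destruct (Lub_Rbar_correct (fun y => exists x, y = f x)) as [U L].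
  assert (B : Rbar_le (Lub_Rbar (fun y => exists x, y = f x)) (Finite M)).
  { apply L. intros y [z ->]. simpl. generalize (HM z). apply Rabs_le_between. }
  specialize (U (f x) (ex_intro _ x eq_refl)).
  destruct (Lub_Rbar _); simpl in *; tauto.
Qed.

Lemma inf_fun_lb {T : Type} (f : T -> R) (x : T) : bounded_fun f -> inf_fun f <= f x.
Proof.
  intros [M HM]. unfold inf_fun.
  destruct (Glb_Rbar_correct (fun y => exists x, y = f x)) as [U L].
  assert (B : Rbar_le (Finite (- M)) (Glb_Rbar (fun y => exists x, y = f x))).
  { apply L. intros y [z ->]. simpl. generalize (HM z). apply Rabs_le_between. }
  specialize (U (f x) (ex_intro _ x eq_refl)).
  destruct (Glb_Rbar _); simpl in *; tauto.
Qed.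

Lemma norm_inf_ub {T : Type} (f : T -> R) (x : T) : bounded_fun f -> Rabs (f x) <= norm_inf f.
Proof.
  intros [M HM]. apply (sup_fun_ub (fun x => Rabs (f x))). exists M. intros y.
  now rewrite Rabs_Rabsolu.
Qed.

Lemma continuous_ge_at_0 (f : R -> R) (c : R) :
  continuous f 0 -> (forall s, 0 < s -> c <= f s) -> c <= f 0.
Proof.
  intros Hf Hc. destruct (Rle_or_lt c (f 0)) as [H | H]; trivial. exfalso.
  assert (He : 0 < c - f 0) by lra.
  destruct (proj1 (filterlim_locally _ _) Hf (mkposreal _ He)) as [d Hd].
  destruct d as [d d0]; simpl in Hd.
  assert (B : ball (0 : R) d (d / 2)).
  { change (Rabs (d / 2 - 0) < d). rewrite Rabs_pos_eq; lra. }
  specialize (Hd (d / 2) B).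
  change (Rabs (f (d / 2) - f 0) < c - f 0) in Hd.
  apply Rabs_lt_between in Hd. specialize (Hc (d / 2)). lra.
Qed.

(** * Gradient bounds from values on the light cone *)

(** Here [gp] and [gm] are the values of [g] at [t + r] and [t - r].  The left-hand
    side is [1 - 2 min (gp, gm) / V]. *)
Lemma gradient_bounds (r V Vr Vt gp gm m : R) :
  0 < r -> 0 < V -> r * Vr + V = gp + gm -> r * Vt = gp - gm ->
  m * V <= 2 * gp -> m * V <= 2 * gm ->
  r * (- (Vr / V) + Rabs (- (Vt / V))) <= 1 - m.
Proof.
  intros Hr HV E1 E2 Hp Hm.
  assert (A : Rabs (- (Vt / V)) = Rabs (r * Vt) / (r * V)).
  { rewrite Rabs_Ropp, Rabs_mult, Rabs_div by lra.
    rewrite (Rabs_pos_eq V), (Rabs_pos_eq r) by lra. field; lra. }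
  rewrite A, E2.
  replace (r * (- (Vr / V) + Rabs (gp - gm) / (r * V)))
    with ((- (r * Vr) + Rabs (gp - gm)) / V) by (field; lra).
  apply Rle_div_l; [lra |].
  replace (r * Vr) with (gp + gm - V) by lra.
  unfold Rabs. destruct (Rcase_abs _); nra.
Qed.

(** If [Vr >= 0], the left-hand side is [2 max (gp, gm) / V - 1].  Otherwise it is
    [1 - 2 min (gp, gm) / V <= 1 - 1 / c], and [c + 1 / c >= 2]. *)
Lemma gradient_abs_bounds (r V Vr Vt gp gm c : R) :
  0 < r -> 0 < V -> 0 < c -> r * Vr + V = gp + gm -> r * Vt = gp - gm ->
  V <= c * (2 * gp) -> V <= c * (2 * gm) ->
  2 * gp <= c * V -> 2 * gm <= c * V ->
  r * (Rabs (- (Vr / V)) + Rabs (- (Vt / V))) <= c - 1.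
Proof.
  intros Hr HV Hc E1 E2 Hp Hm Hp' Hm'.
  assert (A : forall x, Rabs (- (x / V)) = Rabs (r * x) / (r * V)).
  { intros x. rewrite Rabs_Ropp, Rabs_mult, Rabs_div by lra.
    rewrite (Rabs_pos_eq V), (Rabs_pos_eq r) by lra. field; lra. }
  rewrite !A, E2.
  replace (r * Vr) with (gp + gm - V) by lra.
  replace (r * (Rabs (gp + gm - V) / (r * V) + Rabs (gp - gm) / (r * V)))
    with ((Rabs (gp + gm - V) + Rabs (gp - gm)) / V) by (field; lra).
  apply Rle_div_l; [lra |].
  assert (I : forall g, V <= c * (2 * g) -> V - 2 * g <= (c - 1) * V).
  { intros g Hg. assert (V / c <= 2 * g) by (apply Rle_div_l; lra).
    assert (2 - c <= / c).
    { apply (Rmult_le_reg_r c); trivial. rewrite Rinv_l by lra.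
      pose proof (Rle_0_sqr (c - 1)) as Q. unfold Rsqr in Q. lra. }
    assert ((2 - c) * V <= / c * V) by (apply Rmult_le_compat_r; lra).
    unfold Rdiv in *. lra. }
  pose proof (I gp Hp). pose proof (I gm Hm).
  unfold Rabs. repeat destruct (Rcase_abs _); lra.
Qed.

(** * The nonlinear equation *)

Lemma exp_le_compat (x y : R) : x <= y -> exp x <= exp y.
Proof. intros [H | ->]; [now apply Rlt_le, exp_increasing | apply Rle_refl]. Qed.

Section Potential.
Variable g : R -> R.
Hypothesis g_smooth : smooth1 g.
Hypothesis g_pos : forall s, 0 < g s.

Definition potential (p : spacetime) : R := - ln (wave 0 g p).

Lemma wave_pos (p : spacetime) : 0 < wave 0 g p.
Proof. apply cone_int_pos; trivial. now apply smooth1_continuous. Qed.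

Lemma wave_smooth : smooth (wave 0 g).
Proof. intros k. now apply wave_C_k. Qed.

Lemma potential_smooth : smooth potential.
Proof. apply smooth_neg_ln; [apply wave_pos | apply wave_smooth]. Qed.

Lemma potential_radial (t : R) : radial (at_time potential t).
Proof. intros x y E. unfold at_time, potential, wave. simpl fst. now rewrite E. Qed.

Lemma dir_deriv_potential (v p : spacetime) :
  dir_deriv v potential p = - (dir_deriv v (wave 0 g) p * / wave 0 g p).
Proof.
  apply is_dir_unique, is_dir_neg_ln; [apply wave_pos | apply smooth_is_dir, wave_smooth].
Qed.

Lemma potential_equation (p : spacetime) :
  dt (dt potential) p - laplacian potential p = (dt potential p) ^ 2 - grad_sq potential p.
Proof.
  pose proof (wave_solves_linear g p g_smooth) as W. unfold laplacian in W.
  unfold laplacian, grad_sq, dx, dt in *.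
  rewrite !(dir_deriv_2_neg_ln _ (wave 0 g)) by (apply wave_pos || apply wave_smooth).
  rewrite W, !dir_deriv_potential. pose proof (wave_pos p). field. lra.
Qed.

Lemma dt_potential (p : spacetime) :
  dt potential p = - (wave 0 (Derive g) p / wave 0 g p).
Proof.
  unfold dt. rewrite dir_deriv_potential.
  change (dir_deriv _ (wave 0 g)) with (dt (wave 0 g)). now rewrite dt_wave.
Qed.

Lemma u_t_potential (r t : R) :
  u_t potential r t = - (cone_int (weight 0) (Derive g) r t / cone_int (weight 0) g r t).
Proof.
  unfold u_t, profile, at_time. rewrite dt_potential. unfold wave.
  simpl fst; simpl snd. rewrite norm_axis, !cone_int_weight_abs; trivial.
  now apply smooth_Derive.
Qed.

Lemma u_r_potential (r t : R) :
  u_r potential r t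
  = - (cone_int (fun s => s * weight 0 s) (Derive g) r t / cone_int (weight 0) g r t).
Proof.
  unfold u_r, radial_deriv. apply is_derive_unique.
  apply (is_derive_ext (fun r => - ln (cone_int (weight 0) g r t))).
  { intros y. unfold profile, at_time, potential, wave. simpl fst; simpl snd.
    now rewrite norm_axis, cone_int_weight_abs. }
  pose proof (cone_int_derive_r (weight 0) g r t (weight_continuous 0) g_smooth) as D.
  assert (P : 0 < cone_int (weight 0) g r t).
  { apply cone_int_pos; trivial. now apply smooth1_continuous. }
  set (l := cone_int _ (Derive g) r t) in *. clearbody l.
  auto_derive; [split; [eexists; exact D | split; trivial] |].
  replace (Derive _ r) with l by (symmetry; exact (is_derive_unique _ _ _ D)).
  field. lra.
Qed.

(** Strictness needs no uniform bound on [g]: at a given point only the two values of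
    [g] at [t + r] and [t - r] enter. *)
Lemma potential_gradient_lt (r t : R) : 0 < r ->
  u_r potential r t + Rabs (u_t potential r t) < 1 / r.
Proof.
  intros Hr. rewrite u_r_potential, u_t_potential.
  pose proof (g_pos (t + r)) as Hp. pose proof (g_pos (t - r)) as Hm.
  assert (P : 0 < cone_int (weight 0) g r t).
  { apply cone_int_pos; trivial. now apply smooth1_continuous. }
  pose proof (cone_int_r_derivative g r t g_smooth) as E1.
  pose proof (cone_int_t_derivative g r t g_smooth) as E2.
  set (V := cone_int (weight 0) g r t) in *.
  set (m := 2 * Rmin (g (t + r)) (g (t - r)) / V).
  assert (Hm0 : 0 < m).
  { apply Rdiv_lt_0_compat; trivial. pose proof (Rmin_pos _ _ Hp Hm). lra. }
  assert (Em : m * V = 2 * Rmin (g (t + r)) (g (t - r))) by (unfold m; field; lra).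
  apply (Rlt_div_r _ _ _ Hr).
  rewrite Rmult_comm. apply Rle_lt_trans with (1 - m); [| lra].
  apply (gradient_bounds r V _ _ (g (t + r)) (g (t - r))); trivial; rewrite Em.
  - pose proof (Rmin_l (g (t + r)) (g (t - r))). lra.
  - pose proof (Rmin_r (g (t + r)) (g (t - r))). lra.
Qed.

Section Bounded.
Variables lo hi : R.
Hypothesis lo_pos : 0 < lo.
Hypothesis g_lo : forall s, lo <= 2 * g s.
Hypothesis g_hi : forall s, 2 * g s <= hi.

Lemma cone_int_between (r t : R) : lo <= cone_int (weight 0) g r t <= hi.
Proof.
  pose proof (smooth1_continuous g g_smooth) as C.
  pose proof (cone_int_ge g (lo / 2) r t C). pose proof (cone_int_le g (hi / 2) r t C).
  assert (forall s, lo / 2 <= g s) by (intros s; specialize (g_lo s); lra).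
  assert (forall s, g s <= hi / 2) by (intros s; specialize (g_hi s); lra).
  intuition lra.
Qed.

Lemma potential_between (p : spacetime) : - ln hi <= potential p <= - ln lo.
Proof.
  unfold potential, wave. pose proof (cone_int_between (norm (fst p)) (snd p)) as [B1 B2].
  assert (0 < cone_int (weight 0) g (norm (fst p)) (snd p)) by lra.
  split; apply Ropp_le_contravar, ln_le; trivial.
Qed.

Lemma potential_gradient_le (r t : R) : 0 < r ->
  r * (u_r potential r t + Rabs (u_t potential r t)) <= 1 - lo / hi.
Proof.
  intros Hr. rewrite u_r_potential, u_t_potential.
  pose proof (cone_int_between r t) as [B1 B2].
  pose proof (g_lo (t + r)) as Hp. pose proof (g_lo (t - r)) as Hm.
  apply (gradient_bounds r _ _ _ (g (t + r)) (g (t - r))); trivial; try lra;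
    try (now apply cone_int_r_derivative); try (now apply cone_int_t_derivative);
    apply Rle_trans with lo; trivial;
    (apply Rle_trans with (lo / hi * hi); [| right; field; lra]);
    (apply Rmult_le_compat_l; trivial; apply Rlt_le, Rdiv_lt_0_compat; lra).
Qed.

Lemma potential_gradient_abs_le (r t : R) : 0 < r ->
  r * (Rabs (u_r potential r t) + Rabs (u_t potential r t)) <= hi / lo - 1.
Proof.
  intros Hr. rewrite u_r_potential, u_t_potential.
  pose proof (cone_int_between r t) as [B1 B2].
  assert (L : forall z, lo <= z -> hi <= hi / lo * z).
  { intros z Hz. apply Rle_trans with (hi / lo * lo); [right; field; lra |].
    apply Rmult_le_compat_l; trivial. apply Rlt_le, Rdiv_lt_0_compat; lra. }
  apply (gradient_abs_bounds r _ _ _ (g (t + r)) (g (t - r))); trivial; try lra;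
    try (now apply cone_int_r_derivative); try (now apply cone_int_t_derivative).
  - apply Rdiv_lt_0_compat; lra.
  - apply Rle_trans with hi; trivial. now apply L.
  - apply Rle_trans with hi; trivial. now apply L.
  - apply Rle_trans with hi; trivial. now apply L.
  - apply Rle_trans with hi; trivial. now apply L.
Qed.

Lemma r_u_r_bounded :
  bounded_fun (fun p : spacetime => r_radial_deriv (at_time potential (snd p)) (fst p)).
Proof.
  exists (hi / lo - 1). intros [x t]. unfold r_radial_deriv. simpl fst; simpl snd.
  change (radial_deriv (at_time potential t) (norm x)) with (u_r potential (norm x) t).
  pose proof (norm_nonneg x) as [N | N].
  - rewrite Rabs_mult, Rabs_pos_eq by lra.
    eapply Rle_trans; [| apply (potential_gradient_abs_le (norm x) t N)].
    apply Rmult_le_compat_l; [lra |].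
    pose proof (Rabs_pos (u_t potential (norm x) t)). lra.
  - rewrite <- N, Rmult_0_l, Rabs_R0.
    pose proof (cone_int_between 0 0). assert (1 <= hi / lo); [| lra].
    apply Rle_div_r; lra.
Qed.

Lemma r_u_t_bounded :
  bounded_fun (fun p : spacetime => r_times (at_time (dt potential) (snd p)) (fst p)).
Proof.
  exists (hi / lo - 1). intros [x t]. unfold r_times. simpl fst; simpl snd.
  replace (at_time (dt potential) t x) with (u_t potential (norm x) t).
  2:{ rewrite u_t_potential. unfold at_time. now rewrite dt_potential. }
  pose proof (norm_nonneg x) as [N | N].
  - rewrite Rabs_mult, Rabs_pos_eq by lra.
    eapply Rle_trans; [| apply (potential_gradient_abs_le (norm x) t N)].
    apply Rmult_le_compat_l; [lra |].
    pose proof (Rabs_pos (u_r potential (norm x) t)). lra.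
  - rewrite <- N, Rmult_0_l, Rabs_R0.
    pose proof (cone_int_between 0 0). assert (1 <= hi / lo); [| lra].
    apply Rle_div_r; lra.
Qed.

End Bounded.
End Potential.

(** * Bounds on the density in terms of the data *)

Section Data.
Variables u0 u1 : space -> R.
Hypothesis u0_smooth : smooth u0.
Hypothesis u1_smooth : smooth u1.
Hypothesis u0_radial : radial u0.
Hypothesis u1_radial : radial u1.

Let p0 := profile u0.
Let p1 := profile u1.

Definition data_density : R -> R := density (profile u0) (profile u1).

Lemma data_density_smooth : smooth1 data_density.
Proof. now apply density_smooth; apply profile_smooth. Qed.

Lemma data_density_abs (s : R) :
  2 * data_density s = exp (- p0 s) * (1 - Rabs s * Derive p0 (Rabs s) - s * p1 s).
Proof. now apply density_abs; [apply profile_smooth | apply profile_even]. Qed.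

Lemma p1_abs (s : R) : p1 (Rabs s) = p1 s.
Proof. unfold Rabs. destruct (Rcase_abs s); trivial. now apply profile_even. Qed.

Lemma potential_initial (x : space) : potential data_density (x, 0) = u0 x.
Proof.
  unfold potential, wave. simpl fst; simpl snd. unfold data_density.
  rewrite density_cone_int_0, ln_exp, Ropp_involutive.
  - symmetry. now apply radial_profile.
  - now apply profile_smooth.
  - now apply profile_smooth.
  - now apply profile_even.
  - now apply profile_even.
Qed.

Lemma dt_potential_initial (x : space) : (forall s, 0 < data_density s) ->
  dt (potential data_density) (x, 0) = u1 x.
Proof.
  intros P. rewrite dt_potential by (apply data_density_smooth || apply P).
  unfold wave. simpl fst; simpl snd. unfold data_density.
  rewrite density_cone_int_0, Derive_density_cone_int_0;
    try (now apply profile_smooth); try (now apply profile_even).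
  rewrite (radial_profile u1 u1_radial x).
  pose proof (exp_pos (- profile u0 (norm x))). field. lra.
Qed.

Lemma data_density_ge (kappa : R) :
  (forall r, 0 < r -> r * (Derive p0 r + Rabs (p1 r)) <= kappa) ->
  forall s, s <> 0 -> exp (- p0 s) * (1 - kappa) <= 2 * data_density s.
Proof.
  intros H s Hs. rewrite data_density_abs.
  apply Rmult_le_compat_l; [apply Rlt_le, exp_pos |].
  specialize (H (Rabs s) (Rabs_pos_lt s Hs)). rewrite p1_abs, Rmult_plus_distr_l in H.
  rewrite <- Rabs_mult in H. pose proof (Rle_abs (s * p1 s)). lra.
Qed.

Lemma data_density_pos :
  (forall r, 0 < r -> Derive p0 r + Rabs (p1 r) < 1 / r) -> forall s, 0 < data_density s.
Proof.
  intros H s. assert (0 < 2 * data_density s); [| lra].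
  rewrite data_density_abs. apply Rmult_lt_0_compat; [apply exp_pos |].
  destruct (Req_dec s 0) as [-> | Hs].
  - rewrite Rabs_R0. lra.
  - pose proof (Rabs_pos_lt s Hs) as Ps. specialize (H (Rabs s) Ps).
    apply (Rmult_lt_compat_l (Rabs s)) in H; trivial.
    replace (Rabs s * (1 / Rabs s)) with 1 in H by (field; lra).
    rewrite p1_abs, Rmult_plus_distr_l, <- Rabs_mult in H.
    pose proof (Rle_abs (s * p1 s)). lra.
Qed.

Lemma data_density_le (s : R) : bounded_fun (r_radial_deriv u0) -> bounded_fun (r_times u1) ->
  2 * data_density s <= exp (- p0 s) * data_size u0 u1.
Proof.
  intros B0 B1. rewrite data_density_abs.
  apply Rmult_le_compat_l; [apply Rlt_le, exp_pos |]. unfold data_size.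
  pose proof (norm_inf_ub _ ((s, 0, 0) : space) B0) as H0.
  pose proof (norm_inf_ub _ ((s, 0, 0) : space) B1) as H1.
  unfold r_radial_deriv in H0 at 1. unfold r_times in H1 at 1.
  rewrite norm_axis in H0, H1.
  change (radial_deriv u0 (Rabs s)) with (Derive p0 (Rabs s)) in H0.
  change (u1 (s, 0, 0)) with (p1 s) in H1.
  rewrite Rabs_mult, Rabs_Rabsolu, <- Rabs_mult in H1.
  apply Rabs_le_between in H0. apply Rabs_le_between in H1. lra.
Qed.

Lemma data_size_pos : bounded_fun (r_radial_deriv u0) -> bounded_fun (r_times u1) ->
  0 < data_size u0 u1.
Proof.
  intros B0 B1. unfold data_size.
  pose proof (norm_inf_ub _ ((0, 0, 0) : space) B0) as H0.
  pose proof (norm_inf_ub _ ((0, 0, 0) : space) B1) as H1.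
  pose proof (Rabs_pos (r_radial_deriv u0 (0, 0, 0))).
  pose proof (Rabs_pos (r_times u1 (0, 0, 0))). lra.
Qed.

(** The condition on the data speaks only of [r > 0]; the lower bound at [s = 0]
    follows by continuity. *)
Lemma data_density_between (eps : R) : bounded_fun u0 -> data_condition u0 u1 eps ->
  forall s, exp (- sup_fun u0) * eps <= 2 * data_density s
            /\ 2 * data_density s <= exp (- inf_fun u0) * data_size u0 u1.
Proof.
  intros B (E0 & B0 & B1 & H).
  assert (L : forall s, s <> 0 -> exp (- sup_fun u0) * eps <= 2 * data_density s).
  { intros s Hs. eapply Rle_trans; [| apply (data_density_ge (1 - eps)); trivial].
    - replace (1 - (1 - eps)) with eps by ring. apply Rmult_le_compat_r; [lra |].
      apply exp_le_compat, Ropp_le_contravar, (sup_fun_ub u0), B.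
    - intros r Hr. specialize (H r Hr). apply (Rle_div_r _ _ _ Hr) in H.
      rewrite Rmult_comm. exact H. }
  intros s. split.
  - destruct (Req_dec s 0) as [-> | Hs]; [| now apply L].
    apply (continuous_ge_at_0 (fun s => 2 * data_density s)).
    + apply (continuous_scal_r (V := R_NormedModule)), smooth1_continuous, data_density_smooth.
    + intros s Hs. apply L. lra.
  - eapply Rle_trans; [now apply data_density_le |].
    apply Rmult_le_compat_r; [now apply Rlt_le, data_size_pos |].
    apply exp_le_compat, Ropp_le_contravar, (inf_fun_lb u0), B.
Qed.

(** At [r] and [- r] the bounded quantity equals [1 - r p0' - r p1] and
    [1 - r p0' + r p1].  Their minimum is [1 - r (p0' + |p1|)], and their half sum and
    half difference control [r p0'] and [r p1]. *)
Lemma data_condition_of_bounds (c C : R) : 0 < c ->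
  (forall s, c <= exp (p0 s) * (2 * data_density s) <= C) -> data_condition u0 u1 c.
Proof.
  intros Hc H.
  assert (Q : forall s, c <= 1 - Rabs s * Derive p0 (Rabs s) - s * p1 s <= C).
  { intros s. specialize (H s). rewrite data_density_abs, <- Rmult_assoc, <- exp_plus in H.
    rewrite Rplus_opp_r, exp_0, Rmult_1_l in H. exact H. }
  assert (Q2 : forall r, 0 <= r -> c <= 1 - r * Derive p0 r - r * p1 r <= C
                                   /\ c <= 1 - r * Derive p0 r + r * p1 r <= C).
  { intros r Hr. pose proof (Q r) as Q1. pose proof (Q (- r)) as Q1'.
    assert (Er : p1 (- r) = p1 r) by now apply profile_even.
    rewrite Rabs_Ropp, Er in Q1'. rewrite Rabs_pos_eq in * by trivial. lra. }
  split; [exact Hc | split; [| split]].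
  - exists (C + 1). intros x. unfold r_radial_deriv.
    change (radial_deriv u0 (norm x)) with (Derive p0 (norm x)).
    pose proof (Q2 (norm x) (norm_nonneg x)). apply Rabs_le. lra.
  - exists C. intros x. unfold r_times. rewrite (radial_profile u1 u1_radial).
    pose proof (Q2 (norm x) (norm_nonneg x)). fold p1. apply Rabs_le. lra.
  - intros r Hr. apply (Rle_div_r _ _ _ Hr).
    pose proof (Q2 r (Rlt_le _ _ Hr)).
    change (radial_deriv u0 r) with (Derive p0 r). change (profile u1 r) with (p1 r).
    unfold Rabs. destruct (Rcase_abs (p1 r)); lra.
Qed.

(** The solution on the time axis determines [g], since there [v = 2 g(t)]. *)
Lemma data_condition_of_bounded : (forall s, 0 < data_density s) ->
  bounded_fun u0 -> bounded_fun (potential data_density) -> exists eps, data_condition u0 u1 eps.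
Proof.
  intros P [K HK] [B HB].
  exists (exp (- K) * exp (- B)).
  apply (data_condition_of_bounds _ (exp K * exp B)).
  { apply Rmult_lt_0_compat; apply exp_pos. }
  intros s.
  specialize (HK ((s, 0, 0) : space)). specialize (HB (((0, 0, 0), s) : spacetime)).
  change (u0 (s, 0, 0)) with (p0 s) in HK.
  assert (E : 2 * data_density s = exp (- potential data_density ((0, 0, 0), s))).
  { unfold potential, wave. simpl fst; simpl snd.
    rewrite norm_axis, Rabs_R0, cone_int_at_0, Ropp_involutive, exp_ln; trivial.
    specialize (P s). lra. }
  rewrite E. apply Rabs_le_between in HK. apply Rabs_le_between in HB.
  split; apply Rmult_le_compat; try (apply Rlt_le, exp_pos); apply exp_le_compat; lra.
Qed.

End Data.

(** * Global existence and bounds *)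

Theorem proposition1p1 (u0 u1 : space -> R)
  (u0_smooth : smooth u0) (u1_smooth : smooth u1)
  (u0_radial : radial u0) (u1_radial : radial u1)
  (data_lt : forall r : R, 0 < r ->
     radial_deriv u0 r + Rabs (profile u1 r) < 1 / r) :
  exists u : spacetime -> R,
    smooth u /\
    (forall t : R, radial (at_time u t)) /\
    is_solution u0 u1 u /\
    (forall r t : R, 0 < r -> u_r u r t + Rabs (u_t u r t) < 1 / r) /\
    (bounded_fun u0 ->
      ((exists eps : R, data_condition u0 u1 eps) <-> bounded_fun u) /\
      (forall eps : R, data_condition u0 u1 eps ->
        (forall p : spacetime,
           inf_fun u0 - ln (data_size u0 u1) <= u p
           /\ u p <= sup_fun u0 + ln (1 / eps)) /\
        bounded_fun (fun p : spacetime => r_radial_deriv (at_time u (snd p)) (fst p)) /\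
        bounded_fun (fun p : spacetime => r_times (at_time (dt u) (snd p)) (fst p)) /\
        (forall r t : R, 0 < r ->
           u_r u r t + Rabs (u_t u r t) <= 1 / r * (1 - 1 / c_0 u0 u1 eps)) /\
        (forall r t : R, 0 < r ->
           Rabs (u_r u r t) + Rabs (u_t u r t) <= (c_0 u0 u1 eps - 1) / r))).
Proof.
  assert (g_smooth := data_density_smooth u0 u1 u0_smooth u1_smooth).
  assert (g_pos := data_density_pos u0 u1 u0_smooth u0_radial u1_radial data_lt).
  set (g := data_density u0 u1) in *.
  assert (bounds : forall eps, bounded_fun u0 -> data_condition u0 u1 eps ->
    forall p, inf_fun u0 - ln (data_size u0 u1) <= potential g p
              /\ potential g p <= sup_fun u0 + ln (1 / eps)).
  { intros eps B D p.
    pose proof (data_density_between u0 u1 u0_smooth u1_smooth u0_radial u1_radial eps B D) as G.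
    destruct D as (E0 & B0 & B1 & _).
    assert (DS := data_size_pos u0 u1 B0 B1).
    pose proof (potential_between g g_smooth
      (exp (- sup_fun u0) * eps) (exp (- inf_fun u0) * data_size u0 u1)) as PB.
    rewrite !ln_mult, !ln_exp in PB by (trivial; apply exp_pos).
    unfold Rdiv. rewrite Rmult_1_l, ln_Rinv by trivial.
    assert (PB' : - (- inf_fun u0 + ln (data_size u0 u1)) <= potential g p
                  <= - (- sup_fun u0 + ln eps)).
    { apply PB; try (intros s; apply G). apply Rmult_lt_0_compat; trivial; apply exp_pos. }
    lra. }
  exists (potential g).
  split; [now apply potential_smooth |].
  split; [apply potential_radial |].
  split; [split; [| split] |].
  - now apply potential_equation.
  - now apply potential_initial.
  - intros x. now apply dt_potential_initial.
  - split; [intros r t; now apply potential_gradient_lt |].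
    intros B. split.
    + split; [| now apply data_condition_of_bounded].
      intros [eps D].
      set (lower := inf_fun u0 - ln (data_size u0 u1)) in *.
      set (upper := sup_fun u0 + ln (1 / eps)) in *.
      exists (Rmax (- lower) upper).
      intros p. destruct (bounds eps B D p) as [L U]. fold lower upper in L, U.
      pose proof (Rmax_l (- lower) upper). pose proof (Rmax_r (- lower) upper).
      apply Rabs_le. lra.
    + intros eps D.
      pose proof (data_density_between u0 u1 u0_smooth u1_smooth u0_radial u1_radial eps B D) as G.
      fold g in G.
      set (lo := exp (- sup_fun u0) * eps) in *.
      set (hi := exp (- inf_fun u0) * data_size u0 u1) in *.
      assert (E0 := proj1 D).
      assert (DS := data_size_pos u0 u1 (proj1 (proj2 D)) (proj1 (proj2 (proj2 D)))).
      assert (lo0 : 0 < lo) by (apply Rmult_lt_0_compat; trivial; apply exp_pos).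
      assert (hi0 : 0 < hi) by (apply Rmult_lt_0_compat; trivial; apply exp_pos).
      assert (glo : forall s, lo <= 2 * g s) by (intros s; apply G).
      assert (ghi : forall s, 2 * g s <= hi) by (intros s; apply G).
      assert (C0 : c_0 u0 u1 eps = hi / lo).
      { unfold c_0, hi, lo, Rminus. rewrite !exp_plus, !exp_Ropp.
        pose proof (exp_pos (sup_fun u0)). pose proof (exp_pos (inf_fun u0)).
        field. repeat split; lra. }
      split; [now apply bounds |].
      split; [now apply (r_u_r_bounded g g_smooth g_pos lo hi) |].
      split; [now apply (r_u_t_bounded g g_smooth g_pos lo hi) |].
      rewrite C0. split; intros r t Hr.
      * replace (1 / r * (1 - 1 / (hi / lo))) with ((1 - lo / hi) / r) by (field; lra).
        apply (Rle_div_r _ _ _ Hr). rewrite Rmult_comm.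
        now apply potential_gradient_le.
      * apply (Rle_div_r _ _ _ Hr). rewrite Rmult_comm.
        now apply potential_gradient_abs_le.
Qed.
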